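(* Let $G_\omega$ be a weighted tree with at least one edge. If $I(G_\omega)^n$ is Cohen-Macaulay for all $n\ge 1$, then $G$ has a perfect matching $\{x_1y_1,\ldots,x_ty_t\}$, where each $y_i$ is a leaf vertex in $G$. Moreover, setting $\omega_{ij}=\omega(x_ix_j)$ if $x_ix_j\in E(G)$ and $m_i=\omega(x_iy_i)$ for all $i=1,\ldots,t$, the following conditions hold: (1) $2\omega_{ij}\le\min\{m_i,m_j\}$ for any $x_ix_j\in E(G)$; (2) for any two different edges $x_ix_j,x_jx_k\in E(G)$, we have $\omega_{ij}\ne\omega_{jk}$; furthermore, if $\omega_{ij}<\omega_{jk}$, then (a) $m_i\ge\omega_{ij}\lceil\omega_{jk}/(\omega_{jk}-\omega_{ij})\rceil$, and (b) $m_k\ge\omega_{jk}\big(\lceil\omega_{jk}/(\omega_{jk}-\omega_{ij})\rceil-2\big)$.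
   Context: A weighted tree $G_\omega$ is a finite tree $G$ together with a weight function $\omega:E(G)\to\mathbb{Z}_{>0}$. A leaf vertex is a vertex of degree $1$. Let $K$ be a field and $R$ the polynomial ring over $K$ whose variables are the vertices of $G$. The weighted edge ideal is $I(G_\omega)=\big((uv)^{\omega(uv)} : uv\in E(G)\big)\subset R$. An ideal $I\subset R$ is called Cohen-Macaulay if $R/I$ is a Cohen-Macaulay ring. $\lceil a\rceil$ is the smallest integer $\ge a$. *)

(* Defs.v *)
From HB Require Import structures.
From mathcomp Require Import all_boot all_order all_algebra.
From mathcomp Require Import boolp.
From mathcomp Require Import mpoly.

Set Implicit Arguments.
Unset Strict Implicit.
Unset Printing Implicit Defensive.

Import GRing.Theory.
Local Open Scope ring_scope.

(** * Ideals

    Prime, maximal and arbitrary proper ideals are quantified over as boolean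
    predicates [{pred A}], using the closure conditions of [ring_quotient];
    under the classical axioms of [boolp] these are all the subsets of [A].
    Note that [idealr_closed] includes properness ([1 \notin S]). *)

Section Ideals.
Variable A : comNzRingType.
Implicit Types (S I : A -> Prop) (P Q M : {pred A}).

Definition gen_ideal S : A -> Prop := fun a =>
  exists n (c g : 'I_n -> A),
    (forall i, S (g i)) /\ a = \sum_(i < n) c i * g i.

Definition ideal_pow I (n : nat) : A -> Prop :=
  gen_ideal (fun p => exists f : 'I_n -> A,
    (forall i, I (f i)) /\ p = \prod_(i < n) f i).

Definition prime_ideal P : Prop := idealr_closed P /\ prime_idealr_closed P.

Definition maximal_ideal M : Prop :=
  idealr_closed M /\
  forall Q, idealr_closed Q -> {subset M <= Q} -> {subset Q <= M}.

Definition seq_ideal (s : seq A) : A -> Prop := gen_ideal (fun a => a \in s).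

Definition noetherian : Prop :=
  forall Q, idealr_closed Q ->
    exists s : seq A, forall a, a \in Q <-> seq_ideal s a.

(** The second conjunct says that [A / (s)] is nonzero. *)
Definition regular_seq (s : seq A) : Prop :=
  (forall i, (i < size s)%N -> forall a,
     seq_ideal (take i s) (s`_i * a) -> seq_ideal (take i s) a)
  /\ ~ seq_ideal s 1.

Definition depth_is P (d : nat) : Prop :=
  (exists s : seq A, [/\ regular_seq s, {subset s <= P} & size s = d]) /\
  (forall s : seq A, regular_seq s -> {subset s <= P} -> (size s <= d)%N).

(** [C 0 < C 1 < ... < C d = P] is a strict chain of prime ideals. *)
Definition prime_chain P (d : nat) (C : nat -> {pred A}) : Prop :=
  [/\ forall i, (i <= d)%N -> prime_ideal (C i),
      forall i, (i < d)%N ->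
        {subset C i <= C i.+1} /\ ~ {subset C i.+1 <= C i}
    & C d =i P].

Definition height_is P (d : nat) : Prop :=
  (exists C, prime_chain P d C) /\
  (forall d' C, prime_chain P d' C -> (d' <= d)%N).

(** Cohen-Macaulay rings as in Eisenbud, Commutative Algebra, Section 18.2: a
    Noetherian ring in which [depth (M, A) = codim M] for every maximal ideal
    [M].  Both sides are unchanged by localizing at [M], so this says that every
    [A_M] is a Cohen-Macaulay local ring. *)
Definition cohen_macaulay : Prop :=
  noetherian /\
  forall M, maximal_ideal M -> exists d, depth_is M d /\ height_is M d.

End Ideals.

(** * The quotient by a proper ideal given as a [Prop]-valued predicate *)

Section Quotient.
Variable R : comNzRingType.

Definition pred_of_ideal (I : R -> Prop) : {pred R} := fun a => `[< I a >].

Definition ideal_pred (I : R -> Prop) (hI : idealr_closed (pred_of_ideal I)) :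
  {pred R} := pred_of_ideal I.

HB.instance Definition _ (I : R -> Prop)
    (hI : idealr_closed (pred_of_ideal I)) :=
  isIdealr.Build R (ideal_pred hI) hI.

(** [comNzRingType] excludes the zero ring, hence the properness proof [hI]. *)
Definition cohen_macaulay_ideal (I : R -> Prop) : Prop :=
  exists hI : idealr_closed (pred_of_ideal I),
    cohen_macaulay {ideal_quot (ideal_pred hI)}.

End Quotient.

(** * Weighted graphs *)

(** [weight] is only meaningful on pairs joined by an edge. *)
Record weighted_graph (V : finType) := WeightedGraph {
  edge : rel V;
  weight : V -> V -> nat;
  edge_sym : ssrbool.symmetric edge;
  edge_irrefl : irreflexive edge;
  weight_sym : forall u v, edge u v -> weight u v = weight v u;
  weight_gt0 : forall u v, edge u v -> (0 < weight u v)%N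
}.

Section Graphs.
Variables (V : finType) (G : weighted_graph V).

Definition edges : {set {set V}} :=
  [set [set p.1; p.2] | p : V * V & edge G p.1 p.2].

(** Simple cycles have length at least 3: for an edge [uv], the sequence
    [:: u; v] is a [ucycle] as well. *)
Definition tree : Prop :=
  (forall u v, connect (edge G) u v) /\
  (forall c : seq V, ucycle (edge G) c -> (size c <= 2)%N).

Definition leaf (v : V) : Prop := #|[set u | edge G v u]| = 1%N.

Definition perfect_matching (M : {set {set V}}) : Prop :=
  M \subset edges /\ partition M [set: V].

Variable K : fieldType.

Definition vertex_var (v : V) : {mpoly K[#|V|]} := 'X_(enum_rank v).

Definition weighted_edge_ideal : {mpoly K[#|V|]} -> Prop :=
  gen_ideal (fun p => exists u v, edge G u v /\
    p = (vertex_var u * vertex_var v) ^+ weight G u v).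

End Graphs.

(* Main.v *)
Require Import Defs.
From mathcomp Require Import all_boot all_order all_algebra.
From mathcomp Require Import boolp.
From mathcomp Require Import mpoly.
From mathcomp Require Import zify ring.

(** A monomial ideal J of K[V] is tested at the origin, where Cohen-Macaulayness
    makes the depth of K[V]/J at least |V| - |C| for every vertex cover C.  A
    regular sequence of length r can be moved, by Nagata's change of variables
    and a dimension count, so that r - (|V| - |U|) of its terms lie in the ideal
    generated by large powers of the variables of U.  This yields two
    obstructions for a monomial g:
    - if g is not in J but some power of every u in U multiplies g into J, then
      |U| <= |C| (J has no embedded prime);
    - if U = U1 + U2 and large powers of u1 u2 multiply g into J for all u1 in
      U1, u2 in U2, but neither U1 nor U2 alone achieves this, then
      |U| <= |C| + 1 (Hartshorne connectedness).
    The first one, applied to I(G), makes G well-covered, and well-covered trees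
    are matched by their leaves.  The numerical conditions come from explicit
    monomials.  For an edge of weight w between x1 and x2 with m1 < 2w, use
    x1^m1 (x2 y2)^m2 if 2w <= m2 and x1^m1 x2^m2 otherwise, with n = 2.  For
    equal weights w on x_i x_j and x_j x_k, use
    x_i^(m_i) x_j^(w(n - 1)) x_k^(m_k) with n large.  For weights p < q and
    c = ceil(q / (q - p)), use x_i^(m_i) (x_j x_k)^(q(c - 1)) with n = c for (a)
    and (x_i y_i)^(m_i) x_j^(q(c - 2)) x_k^(m_k) with n = c - 1 for (b). *)

Set Implicit Arguments.
Unset Strict Implicit.
Unset Printing Implicit Defensive.

Import GRing.Theory.
Local Open Scope ring_scope.

(** * Regular sequences in a local ring *)

Section LocalRegularSequences.
Variables (A : comNzRingType) (M : A -> Prop).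
Hypothesis MD : forall x y, M x -> M y -> M (x + y).
Hypothesis MM : forall x y, M x -> M (y * x).
Hypothesis M1 : ~ M 1.
Hypothesis Mprime : forall x y, ~ M x -> ~ M y -> ~ M (x * y).
Hypothesis noeth : noetherian A.
Implicit Types (J : A -> Prop) (a b v x y : A) (s l : seq A).

(* Ideals of the localization of [A] at [M] are represented by their
   contractions to [A]. *)
Definition sat_ideal J : Prop :=
  [/\ J 0, forall x y, J x -> J y -> J (x + y),
      forall x y, J x -> J (y * x)
    & forall v x, ~ M v -> J (v * x) -> J x].

(** Contraction to [A] of the ideal generated by [J] and [a] in the local ring at [M]; the factor
    [v] clears denominators. *)
Definition ext J a : A -> Prop :=
  fun x => exists v h, ~ M v /\ J (v * x - a * h).

Definition reg J a : Prop := forall x, J (a * x) -> J x.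

Fixpoint rseq J s : Prop :=
  if s is a :: s' then [/\ M a, reg J a & rseq (ext J a) s'] else True.

Definition exts J s := foldl ext J s.

Lemma not_M_addr v x : ~ M v -> M x -> ~ M (v + x).
Proof.
move=> nv Mx Mvx; apply: nv; rewrite -(addrK x v) -mulN1r.
by apply: MD => //; apply: MM.
Qed.

Lemma sat_idealB J x y : sat_ideal J -> J x -> J y -> J (x - y).
Proof. by case=> _ JD JM _ Jx Jy; apply: JD => //; rewrite -mulN1r; apply: JM. Qed.

Lemma sub_ext J a x : sat_ideal J -> J x -> ext J a x.
Proof. by move=> _ Jx; exists 1, 0; split=> //; rewrite mul1r mulr0 subr0. Qed.

Lemma mem_ext J a : sat_ideal J -> ext J a a.
Proof. by case=> J0 _ _ _; exists 1, 1; split=> //; rewrite mul1r mulr1 subrr. Qed.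

Lemma sat_ideal_ext J a : sat_ideal J -> sat_ideal (ext J a).
Proof.
move=> sJ; case: (sJ) => J0 JD JM JS; split.
- exact: sub_ext.
- move=> x y [v [h [nv Jx]]] [w [k [nw Jy]]].
  exists (v * w), (w * h + v * k); split; first exact: Mprime.
  have -> : v * w * (x + y) - a * (w * h + v * k)
     = w * (v * x - a * h) + v * (w * y - a * k) by ring.
  by apply: JD; apply: JM.
- move=> x y [v [h [nv Jx]]]; exists v, (y * h); split=> //.
  have -> : v * (y * x) - a * (y * h) = y * (v * x - a * h) by ring.
  exact: JM.
- move=> v x nv [w [h [nw Jx]]]; exists (w * v), h; split; first exact: Mprime.
  by rewrite -mulrA.
Qed.

Lemma extC J a b : sat_ideal J -> ext (ext J a) b = ext (ext J b) a.
Proof.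
move=> sJ; case: (sJ) => J0 JD JM JS.
suff H c d x : ext (ext J c) d x -> ext (ext J d) c x.
  by apply/funext=> x; apply/propext; split; apply: H.
move=> [v [h [nv [w [k [nw Jx]]]]]]; exists (w * v), k; split; first exact: Mprime.
exists 1, (w * h); split=> //.
suff -> : 1 * (w * v * x - c * k) - d * (w * h) = w * (v * x - d * h) - c * k by [].
ring.
Qed.

Lemma ext_cong J a b : sat_ideal J -> J (a - b) -> ext J a = ext J b.
Proof.
move=> sJ; case: (sJ) => J0 JD JM JS.
suff H c d x : J (c - d) -> ext J c x -> ext J d x.
  move=> Jab; apply/funext=> x; apply/propext; split; apply: H => //.
  by rewrite -opprB -mulN1r; apply: JM.
move=> Jcd [v [h [nv Jx]]]; exists v, h; split=> //.
have -> : v * x - d * h = v * x - c * h + h * (c - d) by ring.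
by apply: JD => //; apply: JM.
Qed.

Lemma reg_cong J a b : sat_ideal J -> J (a - b) -> reg J a -> reg J b.
Proof.
move=> [J0 JD JM JS] Jab ra x Jbx; apply: ra.
have -> : a * x = b * x + x * (a - b) by ring.
by apply: JD => //; apply: JM.
Qed.

(** * Ascending chains and Nakayama's lemma *)

Fixpoint span_upto (z : nat -> A) k y : Prop :=
  if k is k'.+1 then exists c, span_upto z k' (y - c * z k') else y = 0.

Lemma span_upto_ideal z k :
  [/\ span_upto z k 0, forall x y, span_upto z k x -> span_upto z k y ->
      span_upto z k (x + y) & forall c x, span_upto z k x -> span_upto z k (c * x)].
Proof.
elim: k => [|k [I0 ID IM]] /=.
  by split=> // [x y -> ->|c x ->]; rewrite ?addr0 ?mulr0.
split.
- by exists 0; rewrite mul0r subr0.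
- move=> x y [c Hc] [d Hd]; exists (c + d).
  have -> : x + y - (c + d) * z k = x - c * z k + (y - d * z k) by ring.
  exact: ID.
- move=> c x [d Hd]; exists (c * d).
  have -> : c * x - c * d * z k = c * (x - d * z k) by ring.
  exact: IM.
Qed.

Lemma span_upto_leq z k k' y : (k <= k')%N -> span_upto z k y -> span_upto z k' y.
Proof.
move=> /subnK <-; elim: (k' - k)%N => // m IH H; rewrite addSn /=.
by exists 0; rewrite mul0r subr0; apply: IH.
Qed.

Lemma span_upto_gen z i k : (i < k)%N -> span_upto z k (z i).
Proof.
move=> ik; apply: (@span_upto_leq _ i.+1) => //=.
by exists 1; rewrite mul1r subrr; case: (span_upto_ideal z i).
Qed.

(** The ideals spanned by initial segments of [z] form an ascending chain. Their union is finitely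
    generated, by [noetherian] if it is proper and trivially otherwise, so it is reached at a finite
    stage. *)
Lemma noetherian_span (z : nat -> A) : exists k, span_upto z k (z k).
Proof.
pose Q : {pred A} := fun y => `[< exists k, span_upto z k y >].
have QP y : reflect (exists k, span_upto z k y) (y \in Q) by apply: asboolP.
have [/QP[k k1]|Q1] := boolP (1 \in Q).
  exists k; case: (span_upto_ideal z k) => _ _ IM.
  by rewrite -[z k]mulr1; apply: IM.
have Qid : idealr_closed Q.
  split=> //; first by apply/QP; exists 0%N.
  move=> a x y /QP[k Hx] /QP[k' Hy]; apply/QP; exists (maxn k k').
  case: (span_upto_ideal z (maxn k k')) => _ ID IM; apply: ID.
    by apply: IM; apply: span_upto_leq Hx; apply: leq_maxl.
  by apply: span_upto_leq Hy; apply: leq_maxr.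
have [s Hs] := noeth Qid.
have [k Hk] : exists k, forall x, x \in s -> span_upto z k x.
  have : forall x, x \in s -> x \in Q.
    move=> x xs; apply/Hs; exists 1%N, (fun=> 1), (fun=> x).
    by split=> //; rewrite big_ord1 mul1r.
  elim: s {Hs} => [|a s IH] H; first by exists 0%N.
  have [k Hk] := IH (fun x xs => H x (mem_behead (s := a :: s) xs)).
  have /QP[k' Hk'] := H a (mem_head _ _).
  exists (maxn k k') => x; rewrite inE => /orP[/eqP->|/Hk].
    by apply: span_upto_leq Hk'; apply: leq_maxr.
  by apply: span_upto_leq; apply: leq_maxl.
exists k; have /Hs[n [c [g [Hg ->]]]] : z k \in Q.
  by apply/QP; exists k.+1; apply: span_upto_gen.
case: (span_upto_ideal z k) => I0 ID IM.
by elim/big_ind: _ => // i _; apply/IM/Hk/Hg.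
Qed.

(* Nakayama's lemma in the local ring at [M], for [X] inside [J + a X].  It is
   proved by the ascending chain condition rather than by determinants, so [X]
   need not be an ideal. *)
Lemma nakayama J a (X : A -> Prop) : sat_ideal J -> M a ->
  (forall x, X x -> exists v y, [/\ ~ M v, X y & J (v * x - a * y)]) ->
  forall x, X x -> J x.
Proof.
move=> sJ Ma HX x0 Xx0; case: (sJ) => J0 JD JM JS.
have /choice[F HF] : forall p : {x | X x}, exists q : A * {x | X x},
    ~ M q.1 /\ J (q.1 * sval p - a * sval q.2).
  move=> [x Xx]; have [v [y [nv Xy Jy]]] := HX x Xx.
  by exists (v, exist _ y Xy).
pose zz k := iter k (fun p => (F p).2) (exist _ x0 Xx0).
pose z k := sval (zz k); pose v k := (F (zz k)).1.
have nv k : ~ M (v k) by case: (HF (zz k)).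
have Jv k : J (v k * z k - a * z k.+1) by case: (HF (zz k)).
have [k Hk] := noetherian_span z.
(* Modulo [J] and up to units, each term of [z] is [a] times the next one, so the earlier terms are
   multiples of [a * z m]. *)
have Hspan m y : span_upto z m y -> exists V h, ~ M V /\ J (V * y - a * h * z m).
  elim: m y => [|m IH] y /=.
    by move=> ->; exists 1, 0; split=> //; rewrite mulr0 mulr0 mul0r subr0.
  move=> [c /IH[V [h [nV HJ]]]].
  exists (v m * V), (V * c + a * h); split; first exact: Mprime.
  have -> : v m * V * y - a * (V * c + a * h) * z m.+1
    = v m * (V * (y - c * z m) - a * h * z m) +
      (V * c + a * h) * (v m * z m - a * z m.+1) by ring.
  by apply: JD; apply: JM.
have [V [h [nV HJ]]] := Hspan _ _ Hk.
have Jzk : J (z k).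
  apply: (JS (V - a * h)); last by rewrite mulrBl.
  by apply: not_M_addr => //; rewrite -mulrN mulrC; apply: MM.
have back m : J (z m) -> J x0.
  elim: m => // m IH Jz; apply: IH; apply: (JS (v m)) => //.
  rewrite -(subrK (a * z m.+1) (v m * z m)); apply: JD => //.
  exact: JM.
exact: back Jzk.
Qed.

(** If [b * x] is in [J], then up to a unit [x] is some [a * y] modulo [J], and cancelling [a] puts
    [b * y] in [J]. Thus [nakayama] applies to the annihilator of [b] modulo [J]. *)
Lemma reg_swap J a b : sat_ideal J -> M a -> reg J a -> reg (ext J a) b ->
  reg J b /\ reg (ext J b) a.
Proof.
move=> sJ Ma ra rb; case: (sJ) => J0 JD JM JS; split.
  apply: (nakayama sJ Ma) => x Jbx.
  have [v [y [nv Jy]]] : ext J a x by apply: rb; apply: sub_ext.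
  exists v, y; split=> //; apply: ra.
  have -> : a * (b * y) = v * (b * x) - b * (v * x - a * y) by ring.
  by apply: sat_idealB => //; apply: JM.
move=> x [v [h [nv Jx]]].
have [w [k [nw Jk]]] : ext J a h.
  apply: rb; exists 1, (v * x); split=> //.
  have -> : 1 * (b * h) - a * (v * x) = - 1 * (v * (a * x) - b * h) by ring.
  exact: JM.
exists (w * v), k; split; first exact: Mprime.
apply: ra.
have -> : a * (w * v * x - b * k)
  = w * (v * (a * x) - b * h) + b * (w * h - a * k) by ring.
by apply: JD; apply: JM.
Qed.

Lemma rseq_cons_rcons J a s : sat_ideal J -> rseq J (a :: s) -> rseq J (rcons s a).
Proof.
elim: s J => [|b s IH] J sJ //= [Ma ra [Mb rb rs]].
have [rb' ra'] := reg_swap sJ Ma ra rb.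
split=> //; apply: IH; first exact: sat_ideal_ext.
by split=> //; rewrite extC.
Qed.

Lemma rseq_rcons_cons J a s : sat_ideal J -> rseq J (rcons s a) -> rseq J (a :: s).
Proof.
elim: s J => [|b s IH] J sJ //= [Mb rb /IH[|Ma ra rs]].
  exact: sat_ideal_ext.
have [ra' rb'] := reg_swap sJ Mb rb ra.
by split=> //; split=> //; rewrite extC.
Qed.

Lemma sat_ideal_exts J s : sat_ideal J -> sat_ideal (exts J s).
Proof. by elim: s J => //= a s IH J sJ; apply/IH/sat_ideal_ext. Qed.

Lemma sub_exts J s x : sat_ideal J -> J x -> exts J s x.
Proof.
elim: s J => //= a s IH J sJ Jx; apply: IH; first exact: sat_ideal_ext.
exact: sub_ext.
Qed.

Lemma mem_exts J s x : sat_ideal J -> x \in s -> exts J s x.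
Proof.
elim: s J => //= a s IH J sJ; rewrite inE => /orP[/eqP->|xs].
  by apply: sub_exts; [apply: sat_ideal_ext|apply: mem_ext].
by apply: IH => //; apply: sat_ideal_ext.
Qed.

Lemma rseq_rcons J s a :
  rseq J (rcons s a) <-> [/\ rseq J s, M a & reg (exts J s) a].
Proof.
elim: s J => [|b s IH] J /=; first by split=> [[]|[]].
split=> [[Mb rb /IH[]]|[[Mb rb rs Ma ra]]] //.
by split=> //; apply/IH.
Qed.

(* The monomials with exponents below [B] are numbered by writing the exponents
   as the base [B] digits of [n]. *)
Fixpoint mon (B : nat) (s : seq A) (n : nat) : A :=
  if s is a :: s' then a ^+ (n %% B) * mon B s' (n %/ B) else 1.

(* Nagata's change of coordinates.  Starting from [k = B], it sends the [n]-th
   monomial in [a :: s] to [a ^+ n] modulo the new coordinates, which keeps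
   distinct monomials apart. *)
Fixpoint nagata (a : A) (k B : nat) (s : seq A) : seq A :=
  if s is b :: s' then (b - a ^+ k) :: nagata a (k * B) B s' else [::].

Lemma size_nagata a k B s : size (nagata a k B s) = size s.
Proof. by elim: s k => //= b s IH k; rewrite IH. Qed.

(** Modulo an ideal containing [a], the new coordinates agree with the old ones. *)
Lemma rseq_nagata J a k B s : sat_ideal J -> M a -> J a -> (0 < k)%N -> (0 < B)%N ->
  rseq J s -> rseq J (nagata a k B s).
Proof.
move=> + Ma + + B0; elim: s J k => //= b s IH J k sJ Ja k0 [Mb rb rs].
case: (sJ) => J0 JD JM JS.
have Jb : J (b - (b - a ^+ k)).
  by rewrite opprB addrCA subrr addr0 -(prednK k0) exprSr; apply: JM.
split.
- by apply: MD => //; rewrite -(prednK k0) exprSr -mulNr; apply: MM.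
- exact: reg_cong rb.
- rewrite -(ext_cong sJ Jb); apply: IH => //.
  + exact: sat_ideal_ext.
  + exact: sub_ext.
  + by rewrite muln_gt0 k0.
Qed.

(** Modulo the new coordinates the entries of [s] become [a ^+ k], [a ^+ (k * B)] and so on, so the
    base [B] digits of [n] reassemble in the exponent of [a]. *)
Lemma mon_nagata J a k B s n : sat_ideal J -> (0 < B)%N ->
  (forall x, x \in nagata a k B s -> J x) -> (n < B ^ size s)%N ->
  J (mon B s n - a ^+ (k * n)).
Proof.
move=> sJ B0; case: (sJ) => J0 JD JM JS; elim: s k n => [|b s IH] k n /= H.
  by rewrite expn0 ltnS leqn0 => /eqP->; rewrite muln0 subrr.
rewrite expnS => nB.
have {}IH : J (mon B s (n %/ B) - a ^+ (k * B * (n %/ B))).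
  apply: IH => [x xs|]; first by apply: H; rewrite inE xs orbT.
  by rewrite ltn_divLR // mulnC.
have Jb m : J (b ^+ m - (a ^+ k) ^+ m).
  by rewrite subrXX mulrC; apply/JM/H/mem_head.
have -> : (k * n = k * (n %% B) + k * B * (n %/ B))%N.
  by rewrite {1}(divn_eq n B); lia.
rewrite exprD; set X := mon _ _ _ in IH *; set Y := a ^+ (k * B * _) in IH *.
have -> : b ^+ (n %% B) * X - a ^+ (k * (n %% B)) * Y
  = b ^+ (n %% B) * (X - Y) + Y * (b ^+ (n %% B) - a ^+ (k * (n %% B))) by ring.
by apply: JD; apply: JM => //; rewrite exprM.
Qed.

Variables (K : fieldType) (iota : {rmorphism K -> A}).
Hypothesis M_iota : forall c, M (iota c) -> c = 0.

Definition rel_val B s (g : nat -> K) : A :=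
  \sum_(n < B ^ size s) iota (g n) * mon B s n.

(** In the local ring such a polynomial is a power of [a] times a unit: the lowest nonzero
    coefficient is a unit, and [a] lies in [M]. *)
Lemma reg_poly J a m (g : nat -> K) : sat_ideal J -> M a -> reg J a ->
  (exists2 n, (n < m)%N & g n != 0) ->
  reg J (\sum_(n < m) iota (g n) * a ^+ n).
Proof.
move=> sJ Ma ra [n0 n0m gn0]; case: (sJ) => J0 JD JM JS.
elim: m g n0 n0m gn0 => // m IH g n0 n0m gn0 x.
rewrite big_ord_recl /= expr0 mulr1.
under eq_bigr do rewrite /bump /= add1n exprS mulrCA.
rewrite -mulr_sumr.
have [g0|g0] := eqVneq (g 0%N) 0; last first.
  apply: JS; apply: not_M_addr; first by move=> /M_iota; apply/eqP.
  by rewrite mulrC; apply: MM.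
rewrite g0 rmorph0 add0r -mulrA => /ra.
case: n0 n0m gn0 => [|n0] n0m gn0; first by rewrite g0 eqxx in gn0.
exact: (IH (fun n => g n.+1) n0).
Qed.

(** Permuting the sequence puts [a] last, after the new coordinates [c]. Modulo [c] the value of the
    relation is a nonzero polynomial in [a], hence regular, and may replace [a]. *)
Lemma rseq_exchange J a s B g : sat_ideal J -> rseq J (a :: s) -> (0 < B)%N ->
  (exists2 n, (n < B ^ (size s).+1)%N & g n != 0) ->
  M (rel_val B (a :: s) g) ->
  exists s', size s' = size s /\ rseq J (rel_val B (a :: s) g :: s').
Proof.
move=> sJ [Ma ra rs] B0 Hg Mb; set b := rel_val _ _ _ in Mb *.
pose c := nagata a B B s; exists c; rewrite size_nagata; split=> //.
have rc : rseq J (a :: c).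
  split=> //; apply: rseq_nagata => //; first exact: sat_ideal_ext.
  exact: mem_ext.
apply: rseq_rcons_cons => //.
have /rseq_rcons[rc' _ rac] := rseq_cons_rcons sJ rc.
apply/rseq_rcons; split=> //.
have sJc := sat_ideal_exts c sJ.
apply: (reg_cong sJc _ (reg_poly sJc Ma rac Hg)).
rewrite /b /rel_val /= -sumrB; case: (sJc) => J0 JD JM JS.
elim/big_ind: _; [exact: J0|exact: JD|move=> i _; rewrite -mulrBr; apply: (JM)].
rewrite -opprB -mulN1r; apply: JM.
rewrite -/(mon B (a :: s) i) -[X in a ^+ X]mul1n.
apply: mon_nagata => //= x; rewrite inE expr1 mul1n subrr => /orP[/eqP->//|].
exact: mem_exts.
Qed.

(* [Q] has at most [d] algebraically independent elements modulo it, expressed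
   by bounded-degree relations. *)
Definition trdeg_le (Q : A -> Prop) (d : nat) : Prop :=
  forall s, (d < size s)%N -> exists B g,
    [/\ (0 < B)%N, exists2 n, (n < B ^ size s)%N & g n != 0 & Q (rel_val B s g)].

Lemma rseq_meets J (Q : A -> Prop) d s : sat_ideal J -> (forall x, Q x -> M x) ->
  trdeg_le Q d -> rseq J s -> (d < size s)%N ->
  exists b s', [/\ Q b, rseq J (b :: s') & (size s').+1 = size s].
Proof.
move=> sJ QM dQ; case: s => // a s rs ds.
have [B [g [B0 Hg Qb]]] := dQ _ ds.
have [s' [ss' rs']] := rseq_exchange sJ rs B0 Hg (QM _ Qb).
by exists (rel_val B (a :: s) g), s'; split=> //; rewrite ss'.
Qed.

(** * Comparison with regular sequences in the ring itself *)

Definition sat J : A -> Prop := fun x => exists2 v, ~ M v & J (v * x).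

Lemma rseq_nth J s : (forall i, (i < size s)%N -> M s`_i) ->
  (forall i, (i < size s)%N -> reg (exts J (take i s)) s`_i) -> rseq J s.
Proof.
elim: s J => //= a s IH J HM Hr; split.
- exact: (HM 0%N).
- exact: (Hr 0%N).
- by apply: IH => i is_; [apply: (HM i.+1)|apply: (Hr i.+1)].
Qed.

Lemma seq_ideal_rcons s a x :
  seq_ideal (rcons s a) x <-> exists c, seq_ideal s (x - c * a).
Proof.
split.
  move=> [n [c [g [Hg ->]]]].
  elim: n c g Hg => [|n IH] c g Hg.
    exists 0; rewrite mul0r subr0 big_ord0.
    by exists 0%N, (fun=> 0), (fun=> 0); split; [case|rewrite big_ord0].
  have [|d [m [c' [g' [Hg' e]]]]] :=
    IH (fun i => c (widen_ord (leqnSn n) i)) (fun i => g (widen_ord (leqnSn n) i)).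
    by move=> i; apply: Hg.
  rewrite big_ord_recr /=.
  have := Hg ord_max; rewrite mem_rcons inE => /orP[/eqP->|gs].
    exists (d + c ord_max), m, c', g'; split=> //; rewrite -e; ring.
  exists d, m.+1, (fun i => oapp c' (c ord_max) (unlift ord_max i)),
     (fun i => oapp g' (g ord_max) (unlift ord_max i)); split.
    by move=> i; case: unliftP => [j _|_] //=.
  rewrite big_ord_recr /= unlift_none /= addrAC e; congr (_ + _).
  apply: eq_bigr => i _.
  suff -> : unlift ord_max (widen_ord (leqnSn m) i) = Some i by [].
  have -> : widen_ord (leqnSn m) i = lift ord_max i; last by rewrite liftK.
  by apply: val_inj; rewrite /= /bump leqNgt ltn_ord.
move=> [d [n [c [g [Hg e]]]]].
exists n.+1, (fun i => oapp c d (unlift ord0 i)), (fun i => oapp g a (unlift ord0 i)).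
split.
  by move=> i; case: unliftP => [j _|_] /=; rewrite mem_rcons inE ?Hg ?orbT ?eqxx.
rewrite big_ord_recl unlift_none /=.
under eq_bigr do rewrite liftK /=.
by rewrite -e; ring.
Qed.

Lemma seq_ideal_closed s :
  [/\ seq_ideal s 0, forall x y, seq_ideal s x -> seq_ideal s y -> seq_ideal s (x + y)
    & forall c x, seq_ideal s x -> seq_ideal s (c * x)].
Proof.
elim/last_ind: s => [|s a [I0 ID IM]].
  have H x : seq_ideal [::] x <-> x = 0.
    split=> [[[|n] [c [g [Hg ->]]]]|->]; first by rewrite big_ord0.
      by have := Hg ord0.
    by exists 0%N, (fun=> 0), (fun=> 0); split; [case|rewrite big_ord0].
  split=> [|x y|c x]; rewrite ?H //; first by move=> -> ->; rewrite addr0.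
  by move=> ->; rewrite mulr0.
split=> [|x y|c x]; rewrite !seq_ideal_rcons.
- by exists 0; rewrite mul0r subr0.
- move=> [c Hc] [d Hd]; exists (c + d).
  have -> : x + y - (c + d) * a = x - c * a + (y - d * a) by ring.
  exact: ID.
- move=> [d Hd]; exists (c * d).
  have -> : c * x - c * d * a = c * (x - d * a) by ring.
  exact: IM.
Qed.

Lemma sat_ideal_sat s : sat_ideal (sat (seq_ideal s)).
Proof.
case: (seq_ideal_closed s) => I0 ID IM; split.
- by exists 1 => //; rewrite mulr0.
- move=> x y [v nv Hv] [w nw Hw]; exists (v * w); first exact: Mprime.
  have -> : v * w * (x + y) = w * (v * x) + v * (w * y) by ring.
  by apply: ID; apply: IM.
- by move=> x y [v nv Hv]; exists v => //; rewrite mulrCA; apply: IM.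
- by move=> v x nv [w nw H]; exists (w * v); [apply: Mprime|rewrite -mulrA].
Qed.

Lemma exts_sat s : exts (sat (seq_ideal [::])) s = sat (seq_ideal s).
Proof.
elim/last_ind: s => // s a IH.
rewrite /exts foldl_rcons -/(exts _ s) IH.
case: (seq_ideal_closed s) => I0 ID IM.
apply/funext=> x; apply/propext; split.
  move=> [v [h [nv [w nw H]]]]; exists (w * v); first exact: Mprime.
  apply/seq_ideal_rcons; exists (w * h).
  by have -> : w * v * x - w * h * a = w * (v * x - a * h) by ring.
move=> [v nv /seq_ideal_rcons[c Hc]]; exists v, c; split=> //.
by exists 1 => //; rewrite mul1r (mulrC a).
Qed.

(** Regularity passes to the localization: a denominator [v] can be moved onto the element being
    tested. *)
Lemma regular_rseq s : regular_seq s -> (forall x, x \in s -> M x) ->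
  rseq (sat (seq_ideal [::])) s.
Proof.
move=> [Hs _] HM; apply: rseq_nth => i si; first by apply/HM/mem_nth.
rewrite exts_sat => x [v nv H]; exists v => //.
by apply: Hs => //; rewrite mulrCA.
Qed.

End LocalRegularSequences.

(** * Monomial ideals *)

Section Monomials.
Variables (n : nat) (K : fieldType).
Implicit Types (p q : {mpoly K[n]}) (s : seq {mpoly K[n]}) (m : 'X_{1..n}) (U : {set 'I_n}).

Lemma mcoeffM_neq0 p q m : (p * q)@_m != 0 ->
  exists m1 m2, [/\ m = (m1 + m2)%MM, p@_m1 != 0 & q@_m2 != 0].
Proof.
rewrite -mcoeff_msupp => /msuppM_le /allpairsP[[m1 m2] /= []].
by rewrite !mcoeff_msupp => *; exists m1, m2.
Qed.

Definition bounded_by d p := forall m, p@_m != 0 -> (mdeg m <= d)%N.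

Lemma bounded_byM d e p q : bounded_by d p -> bounded_by e q -> bounded_by (d + e) (p * q).
Proof.
move=> Hp Hq m /mcoeffM_neq0[m1 [m2 [-> /Hp H1 /Hq H2]]].
by rewrite mdegD leq_add.
Qed.

Lemma bounded_by1 : bounded_by 0 1.
Proof. by move=> m; rewrite mcoeff1; case: (m =P 0%MM) => [->|_]; rewrite ?mdeg0 ?eqxx. Qed.

Lemma bounded_byX d p k : bounded_by d p -> bounded_by (d * k) (p ^+ k).
Proof.
move=> Hp; elim: k => [|k IH]; first by rewrite muln0; apply: bounded_by1.
by rewrite exprS mulnS; apply: bounded_byM.
Qed.

Lemma bounded_byW d e p : (d <= e)%N -> bounded_by d p -> bounded_by e p.
Proof. by move=> de Hp m /Hp /leq_trans; apply. Qed.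

Lemma ex_bounded_by s : exists d, forall p, p \in s -> bounded_by d p.
Proof.
elim: s => [|q s [d IH]]; first by exists 0%N.
exists (maxn d (msize q)) => p; rewrite inE => /orP[/eqP->|/IH].
  move=> m; rewrite -mcoeff_msupp => /msize_mdeg_lt /ltnW /leq_trans; apply.
  exact: leq_maxr.
by apply: bounded_byW; apply: leq_maxl.
Qed.

Lemma bounded_by_mon d B s k : (0 < B)%N -> (forall p, p \in s -> bounded_by d p) ->
  bounded_by (size s * (d * B)) (mon B s k).
Proof.
move=> B0; elim: s k => [|p s IH] k H /=; first exact: bounded_by1.
rewrite mulSn; apply: bounded_byM.
  apply: (@bounded_byW (d * (k %% B))); last by apply/bounded_byX/H/mem_head.
  by rewrite leq_mul2l (ltnW (ltn_pmod _ B0)) orbT.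
by apply: IH => q qs; apply: H; rewrite inE qs orbT.
Qed.

(** The monomials surviving modulo the [N]-th powers of the variables in [U], with all exponents at
    most [D]. *)
Definition box U (N D : nat) : {set {ffun 'I_n -> 'I_D.+1}} :=
  [set h : {ffun 'I_n -> 'I_D.+1} | [forall u in U, (h u < N)%N]].

Lemma card_box U N D : (#|box U N D| <= N ^ #|U| * D.+1 ^ #|~: U|)%N.
Proof.
pose F (i : 'I_n) : pred 'I_D.+1 := fun k => (i \in U) ==> (k < N)%N.
have -> : #|box U N D| = #|family F|.
  apply: eq_card => h; rewrite inE; apply/forallP/familyP => H i.
    by rewrite -topredE /=; apply: H.
  by have := H i; rewrite -topredE.
rewrite card_family foldrE big_map big_enum /= (bigID (mem U)) /= leq_mul //.
  rewrite -prod_nat_const leq_prod // => i iU.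
  rewrite cardE -(size_map val) -[leqRHS](size_iota 0) uniq_leq_size //.
    by rewrite map_inj_uniq ?enum_uniq //; apply: val_inj.
  move=> k /mapP[j] + ->; rewrite mem_enum /F iU mem_iota => jN.
  by rewrite leq0n add0n.
rewrite -prod_nat_const [leqRHS](eq_bigl (fun i => i \notin U)); last first.
  by move=> i; rewrite inE.
by rewrite leq_prod // => i _; rewrite -[leqRHS]card_ord max_card.
Qed.

(** There are [B ^ size s] monomials in [s] with exponents below [B], but the number of coefficients
    that must vanish grows only like [B ^ #|~: U|]. *)
Lemma polynomial_relation U N s : (0 < N)%N -> (#|~: U| < size s)%N ->
  exists B (g : nat -> K),
    [/\ (0 < B)%N, exists2 k, (k < B ^ size s)%N & g k != 0
      & forall m, (rel_val (@mpolyC n K) B s g)@_m != 0 ->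
          exists2 u, u \in U & (N <= m u)%N].
Proof.
move=> N0 ds; have [d Hd] := ex_bounded_by s.
pose e := (size s * d).+1.
(* As [D.+1 <= e * B], the box has at most [B.-1 * B ^ #|~: U|] elements, fewer than
   [B ^ size s]. *)
pose B := (N ^ #|U| * e ^ #|~: U|).+1.
have B0 : (0 < B)%N by [].
pose D := (size s * (d * B))%N.
have cardF : (#|box U N D| < B ^ size s)%N.
  apply: leq_ltn_trans (card_box U N D) _.
  have HD : (D.+1 <= e * B)%N by rewrite /D /e mulnA mulSn addnC -addn1 leq_add2l.
  apply: (@leq_ltn_trans (B.-1 * B ^ #|~: U|)).
    rewrite /= -mulnA leq_mul2l -expnMn; apply/orP; right.
    by case: #|~: U| => // k; rewrite leq_exp2r.
  apply: (@leq_trans (B ^ #|~: U|.+1)); last by rewrite leq_pexp2l.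
  by rewrite expnS ltn_mul2r expn_gt0 /=.
pose mn (h : {ffun 'I_n -> 'I_D.+1}) : 'X_{1..n} := [multinom nat_of_ord (h i) | i < n].
(* Rows are the monomials in [s] and columns the coefficients to be cancelled; with more rows than
   columns the left kernel is nonzero. *)
pose G : 'M[K]_(B ^ size s, #|box U N D|) :=
  \matrix_(i, j) (mon B s i)@_(mn (enum_val j)).
have /rowV0Pn[v /sub_kermxP vG v0] : kermx G != 0.
  rewrite kermx_eq0 /row_free; apply/negP => /eqP rG.
  by have := rank_leq_col G; rewrite rG leqNgt cardF.
pose g k := if insub k is Some i then v 0 i else 0.
have gE (i : 'I_(B ^ size s)) : g i = v 0 i by rewrite /g valK.
exists B, g; split=> //.
  have /existsP[i vi] : [exists i, v 0 i != 0].
    apply: contraR v0; rewrite negb_exists => /forallP H; apply/eqP/rowP => i.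
    by rewrite mxE; apply/eqP; have := H i; rewrite negbK.
  by exists i; rewrite ?ltn_ord ?gE.
move=> m Hm.
have [/existsP[u /andP[uU Nu]]|] := boolP [exists u, (u \in U) && (N <= m u)%N].
  by exists u.
rewrite negb_exists => /forallP Hu; case/negP: Hm; apply/eqP.
have [mD|mD] := leqP (mdeg m) D; last first.
  rewrite /rel_val raddf_sum big1 //= => i _; rewrite mcoeffCM.
  apply/eqP; rewrite mulf_eq0; apply/orP; right.
  by apply: contraLR mD; rewrite -leqNgt; apply: bounded_by_mon.
have mi i : (m i <= D)%N.
  by apply: leq_trans mD; rewrite mdegE (bigD1 i) //= leq_addr.
pose h := [ffun i => inord (m i) : 'I_D.+1].
have mh : mn h = m by apply/mnmP => i; rewrite mnmE ffunE inordK // ltnS.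
have hF : h \in box U N D.
  rewrite inE; apply/forallP => u; apply/implyP => uU.
  by rewrite ffunE inordK ?ltnS //; have := Hu u; rewrite uU -ltnNge.
have /rowP/(_ (enum_rank_in hF h)) := vG; rewrite !mxE => <-.
rewrite /rel_val raddf_sum; apply: eq_bigr => i _ /=.
by rewrite mcoeffCM gE mxE enum_rankK_in // mh.
Qed.

End Monomials.

Lemma rmorph_mon (A C : comNzRingType) (f : {rmorphism A -> C}) B s k :
  f (mon B s k) = mon B (map f s) k.
Proof.
by elim: s k => [|a s IH] k /=; rewrite ?rmorph1 // rmorphM rmorphXn IH.
Qed.

(** * The quotient by a monomial ideal, near the origin *)

Section MonomialQuotient.
Variables (n : nat) (K : fieldType) (S : 'X_{1..n} -> Prop).
Hypothesis S_add : forall m m', S m -> S (m + m')%MM.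
Implicit Types (p q : {mpoly K[n]}) (m : 'X_{1..n}) (U W : {set 'I_n}).

Definition mon_ideal (T : 'X_{1..n} -> Prop) p : Prop := forall m, p@_m != 0 -> T m.

Definition meets W m : Prop := exists2 i, i \in W & (0 < m i)%N.

Lemma mon_ideal0 T : mon_ideal T 0.
Proof. by move=> m; rewrite mcoeff0 eqxx. Qed.

Lemma mon_idealD T p q : mon_ideal T p -> mon_ideal T q -> mon_ideal T (p + q).
Proof.
move=> Tp Tq m; rewrite mcoeffD; have [->|/Tp//] := eqVneq (p@_m) 0.
by rewrite add0r; apply: Tq.
Qed.

Lemma mon_idealB T p q : mon_ideal T p -> mon_ideal T q -> mon_ideal T (p - q).
Proof.
move=> Tp Tq; apply: mon_idealD => // m; rewrite mcoeffN oppr_eq0; exact: Tq.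
Qed.

Lemma mon_idealM (T : 'X_{1..n} -> Prop) p q :
  (forall m m', T m -> T (m + m')%MM) -> mon_ideal T p -> mon_ideal T (q * p).
Proof.
move=> T_add Tp m /mcoeffM_neq0[m1 [m2 [-> _ /Tp Tm2]]].
by rewrite addmC; apply: T_add.
Qed.

Lemma meetsD W m m' : meets W m -> meets W (m + m')%MM.
Proof. by move=> [i iW mi]; exists i; rewrite // mnmDE addn_gt0 mi. Qed.

Definition kill W : n.-tuple {mpoly K[n]} := [tuple if i \in W then 0 else 'X_i | i < n].

Lemma kill_monomial W m :
  'X_[m] \mPo kill W = if `[< meets W m >] then 0 else 'X_[m].
Proof.
rewrite comp_mpolyX; case: asboolP => [[i iW mi]|H].
  by rewrite (bigD1 i) //= tnth_mktuple iW expr0n gtn_eqF // mul0r.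
rewrite [RHS]mpolyXE_id; apply: eq_bigr => i _; rewrite tnth_mktuple.
case: ifP => // iW; suff -> : m i = 0%N by rewrite !expr0.
by apply/eqP; rewrite -leqn0 leqNgt; apply/negP => mi; apply: H; exists i.
Qed.

Lemma mcoeff_kill W p m : (p \mPo kill W)@_m = if `[< meets W m >] then 0 else p@_m.
Proof.
rewrite comp_mpolyEX raddf_sum /=; case: asboolP => H.
  rewrite big1 // => i _; rewrite mcoeffZ kill_monomial.
  case: asboolP => [_|Hi]; first by rewrite mcoeff0 mulr0.
  rewrite mcoeffX; case: eqP => [e|_]; last by rewrite mulr0.
  by case: Hi; rewrite e.
rewrite [in RHS](mpolyE p) raddf_sum /=.
apply: eq_bigr => i _; rewrite !mcoeffZ kill_monomial.
case: asboolP => // Hi; rewrite mcoeff0 mcoeffX; case: eqP => // e.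
by case: H; rewrite -e.
Qed.

Lemma mon_ideal_kill W p : mon_ideal (meets W) p <-> p \mPo kill W = 0.
Proof.
split=> [H|H m Hm].
  apply/mpolyP => m; rewrite mcoeff_kill mcoeff0; case: asboolP => // Hm.
  by apply/eqP; apply: contra_notT Hm => /H.
apply: contra_neqP Hm => Hm.
have : (p \mPo kill W)@_m = 0 by rewrite H mcoeff0.
by rewrite mcoeff_kill; case: asboolP.
Qed.

(* The ideal [S] is unchanged by localizing at the origin. *)
Lemma mon_ideal_cancel p q : q@_0%MM != 0 -> mon_ideal S (q * p) -> mon_ideal S p.
Proof.
move=> q0 Sqp m; have [d] := ubnP (mdeg m); elim: d m => // d IH m md pm.
apply: contrapT => nS; suff : (q * p)@_m != 0 by move/Sqp.
have -> : p = p - p@_m *: 'X_[m] + p@_m *: 'X_[m] by rewrite subrK.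
have qX : (q * 'X_[m])@_m = q@_0%MM by rewrite -{1}[m]addm0 mcoeffMX.
rewrite mulrDr mcoeffD -scalerAr mcoeffZ qX.
suff -> : (q * (p - p@_m *: 'X_[m]))@_m = 0 by rewrite add0r mulf_neq0.
apply/eqP; apply: contra_notT nS => /mcoeffM_neq0[m1 [m2 [mE _]]].
rewrite mcoeffB mcoeffZ mcoeffX; have [<-|m2m] := eqVneq m m2.
  by rewrite mulr1 subrr eqxx.
rewrite mulr0 subr0 => pm2; rewrite mE addmC; apply: S_add.
apply: IH => //; rewrite -ltnS; apply: leq_trans md.
rewrite mE mdegD ltnS -[X in (X < _)%N]add0n ltn_add2r lt0n mdeg_eq0.
by apply: contra_neq m2m => m10; rewrite mE m10 add0m.
Qed.

Variables (A : comNzRingType) (pi : {rmorphism {mpoly K[n]} -> A}).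
Hypothesis pi_surj : forall a, exists p, pi p = a.
Hypothesis pi_eq0 : forall p, pi p = 0 <-> mon_ideal S p.
Variable Cov : {set 'I_n}.
Hypothesis S_cover : forall m, S m -> meets Cov m.

Definition quot_ideal W : {pred A} :=
  fun a => `[< exists p, pi p = a /\ mon_ideal (meets W) p >].

Lemma mem_quot_ideal W p : Cov \subset W ->
  (pi p \in quot_ideal W) <-> mon_ideal (meets W) p.
Proof.
move=> CW; split=> [/asboolP[q [pq Hq]]|H]; last by apply/asboolP; exists p.
rewrite -(subrK q p); apply: mon_idealD => //.
have /pi_eq0 H : pi (p - q) = 0 by rewrite rmorphB /= pq subrr.
by move=> m /H /S_cover [i iC mi]; exists i => //; apply: (subsetP CW).
Qed.

(** The variables of [W] generate the kernel of the substitution [kill W], which takes values in a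
    domain. As [Cov \subset W], this kernel contains the monomial ideal and descends to [A]. *)
Lemma quot_ideal_prime W : Cov \subset W -> prime_ideal (quot_ideal W).
Proof.
move=> CW; split.
  split.
  - by rewrite -(rmorph0 pi); apply/mem_quot_ideal => //; apply: mon_ideal0.
  - apply/negP; rewrite -(rmorph1 pi) => /(mem_quot_ideal _ CW) /(_ 0%MM).
    by rewrite mcoeff1 eqxx oner_eq0 => /(_ isT) [i _]; rewrite mnm0E.
  - move=> a x y; have [p <-] := pi_surj a; have [q <-] := pi_surj x.
    have [r <-] := pi_surj y; move=> /(mem_quot_ideal _ CW) Hq /(mem_quot_ideal _ CW) Hr.
    rewrite -rmorphM -rmorphD; apply/mem_quot_ideal => //.
    by apply: mon_idealD => //; apply: mon_idealM => // m m'; apply: meetsD.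
move=> x y; have [p <-] := pi_surj x; have [q <-] := pi_surj y.
rewrite -rmorphM => /(mem_quot_ideal _ CW)/mon_ideal_kill /eqP.
rewrite rmorphM mulf_eq0 => /orP[] /eqP /mon_ideal_kill /(mem_quot_ideal _ CW) ->//.
by rewrite orbT.
Qed.

Definition origin : {pred A} := quot_ideal setT.

Lemma mem_origin p : (pi p \in origin) = (p@_0%MM == 0).
Proof.
apply/idP/eqP => [/(mem_quot_ideal _ (subsetT _)) H|H].
  apply/eqP; apply: contraT => /H [i _]; by rewrite mnm0E.
apply/mem_quot_ideal; first exact: subsetT.
move=> m Hm; have : m != 0%MM by apply: contraNneq Hm => ->; rewrite H.
rewrite -mdeg_eq0 mdegE sum_nat_eq0 negb_forall => /existsP[i /= mi].
by exists i; rewrite ?inE // lt0n.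
Qed.

Lemma origin_maximal : maximal_ideal origin.
Proof.
split; first by case: (quot_ideal_prime (subsetT Cov)).
move=> Q [Q0 Q1 QD] sub x; have [p <-] := pi_surj x => Qp.
rewrite mem_origin; apply: contraNT Q1 => p0.
have Hd : pi ((p@_0%MM)%:MP - p) \in Q.
  by apply: sub; rewrite mem_origin mcoeffB mcoeffC eqxx mulr1 subrr.
have : pi (p@_0%MM)%:MP \in Q.
  by rewrite -(subrK p (p@_0%MM)%:MP) rmorphD /= addrC -[pi p]mul1r QD.
move=> /(QD (pi (p@_0%MM)^-1%:MP) _ 0)/(_ Q0).
by rewrite addr0 -rmorphM -mpolyCM mulVf // rmorph1.
Qed.

(** Starting from the variables of the cover, the others are added one at a time. *)
Lemma origin_chain : exists C, prime_chain origin (n - #|Cov|) C.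
Proof.
pose e := enum (~: Cov).
have se : size e = (n - #|Cov|)%N by rewrite -cardE cardsCs setCK card_ord.
pose W k := Cov :|: [set i in take k e].
have CW k : Cov \subset W k by apply: subsetUl.
exists (fun k => quot_ideal (W k)); split.
- by move=> k _; apply: quot_ideal_prime.
- move=> k ks.
  have sz : (k < size e)%N by rewrite se.
  have [i0 _] : exists i0, i0 \in e.
    by move: sz; case: (e) => // a ? _; exists a; apply: mem_head.
  set x := nth i0 e k.
  have tE : take k.+1 e = rcons (take k e) x by rewrite (take_nth i0).
  split=> [a|H].
    have [p <-] := pi_surj a => /(mem_quot_ideal _ (CW _)) H.
    apply/(mem_quot_ideal _ (CW _)) => m /H[i iW mi]; exists i => //.
    by move: iW; rewrite !inE tE mem_rcons inE => /orP[->|->]; rewrite ?orbT.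
  have /H : pi 'X_x \in quot_ideal (W k.+1).
    apply/(mem_quot_ideal _ (CW _)) => m; rewrite mcoeffX.
    case: (_ =P m) => [<- _|_]; last by rewrite eqxx.
    by exists x; rewrite ?mnm1E ?eqxx // !inE tE mem_rcons mem_head orbT.
  move=> /(mem_quot_ideal _ (CW _))/(_ U_(x)%MM); rewrite mcoeffX eqxx oner_eq0.
  move=> /(_ isT)[i iW]; rewrite mnm1E lt0b => /eqP xi; move: iW; rewrite -xi.
  rewrite !inE => /orP[xC|].
    have : x \in e by apply: mem_nth.
    by rewrite mem_enum inE xC.
  have : uniq (take k.+1 e) by rewrite take_uniq // enum_uniq.
  by rewrite tE rcons_uniq => /andP[/negP].
- suff -> : W (n - #|Cov|)%N = setT by [].
  by apply/setP => i; rewrite !inE -se take_size mem_enum inE orbN.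
Qed.

(** * Depth obstructions from monomials *)

Hypothesis A_CM : cohen_macaulay A.

Let MP (a : A) : Prop := a \in origin.

Lemma origin_idealr : idealr_closed origin.
Proof. by case: (quot_ideal_prime (subsetT Cov)). Qed.

Lemma MPD x y : MP x -> MP y -> MP (x + y).
Proof. by case: origin_idealr => _ _ QD Mx My; rewrite /MP -[x]mul1r QD. Qed.
Lemma MPM x y : MP x -> MP (y * x).
Proof. by case: origin_idealr => Q0 _ QD Mx; rewrite /MP -[y * x]addr0 QD. Qed.
Lemma MP1 : ~ MP 1. Proof. by case: origin_idealr => _ /negP. Qed.
Lemma MPprime x y : ~ MP x -> ~ MP y -> ~ MP (x * y).
Proof.
case: (quot_ideal_prime (subsetT Cov)) => _ Mp nx ny /Mp /orP[]; by [].
Qed.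

Let J0 := sat MP (seq_ideal [::]).

Lemma sJ0 : sat_ideal MP J0.
Proof. exact: (sat_ideal_sat MP1 MPprime). Qed.

Lemma J0_pi p : J0 (pi p) <-> mon_ideal S p.
Proof.
have nil_ideal x : seq_ideal [::] x <-> x = 0 :> A.
  split=> [[[|k] [c [g [Hg ->]]]]|->]; first by rewrite big_ord0.
    by have := Hg ord0.
  by exists 0%N, (fun=> 0), (fun=> 0); split; [case|rewrite big_ord0].
split=> [[v nv /nil_ideal]|/pi_eq0 ->].
  have [q qv] := pi_surj v; rewrite -qv -rmorphM => /pi_eq0.
  by apply: mon_ideal_cancel; move/negP: nv; rewrite -qv mem_origin.
by exists 1; [apply: MP1|apply/nil_ideal; rewrite mulr0].
Qed.

(** At the origin the depth equals the height, which [origin_chain] bounds from below. *)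
Lemma CM_rseq : exists s, rseq MP J0 s /\ (n - #|Cov| <= size s)%N.
Proof.
have [noe /(_ _ origin_maximal)[d [[[s [rs sM sd]] _] [_ Hh]]]] := A_CM.
have [C HC] := origin_chain; exists s; split; last by rewrite sd (Hh _ _ HC).
exact: (regular_rseq MP1 MPprime).
Qed.

Definition powers U (N : nat) m : Prop := exists2 u, u \in U & (N <= m u)%N.

Definition powers_ideal U N a : Prop := exists p, pi p = a /\ mon_ideal (powers U N) p.

Lemma trdeg_powers_ideal U N : (0 < N)%N ->
  trdeg_le (pi \o @mpolyC n K) (powers_ideal U N) #|~: U|.
Proof.
move=> N0 s ds.
have [s' Hs'] : exists s', map pi s' = s.
  elim: s {ds} => [|a s [s' <-]]; first by exists [::].
  by have [p <-] := pi_surj a; exists (p :: s').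
have [|B [g [B0 Hg HQ]]] := polynomial_relation (U := U) (s := s') N0.
  by rewrite -(size_map pi) Hs'.
exists B, g; rewrite -Hs' size_map; split=> //.
exists (rel_val (@mpolyC n K) B s' g); split=> //.
rewrite /rel_val rmorph_sum size_map; apply: eq_bigr => i _.
by rewrite rmorphM rmorph_mon.
Qed.

Lemma powers_ideal_origin U N a : (0 < N)%N -> powers_ideal U N a -> MP a.
Proof.
move=> N0 [p [<- Hp]]; rewrite /MP mem_origin; apply: contraT => /Hp[u _].
by rewrite mnm0E leqNgt N0.
Qed.

Lemma iota_origin c : MP ((pi \o @mpolyC n K) c) -> c = 0.
Proof. by rewrite /MP /= mem_origin mcoeffC eqxx mulr1 => /eqP. Qed.

Let noeA : noetherian A. Proof. by case: A_CM. Qed.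

Lemma rseq_meets_powers U N J s : (0 < N)%N -> sat_ideal MP J -> rseq MP J s ->
  (#|~: U| < size s)%N -> exists p s',
    [/\ mon_ideal (powers U N) p, rseq MP J (pi p :: s') & (size s').+1 = size s].
Proof.
move=> N0 sJ rs Us.
have [b [s' [[p [<- Hp]] rs' ss']]] :=
  rseq_meets MPD MPM MP1 MPprime noeA iota_origin sJ
   (fun x => powers_ideal_origin N0) (trdeg_powers_ideal N0) rs Us.
by exists p, s'.
Qed.

(* The class of [X^g] is killed by powers of the variables in [U], whereas a
   nonzerodivisor lies in the ideal of these powers. *)
Lemma monomial_depth0 U N g : (0 < N)%N -> ~ S g ->
  (forall u, u \in U -> S (g + U_(u) *+ N)%MM) -> (#|U| <= #|Cov|)%N.
Proof.
move=> N0 nSg HU; rewrite leqNgt; apply/negP => CU; apply: nSg.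
have [s [rs ss]] := CM_rseq.
have [|p [s' [Hp [_ rp _] _]]] := rseq_meets_powers (U := U) N0 sJ0 rs.
  apply: leq_trans ss; have := cardsC U; rewrite card_ord; lia.
suff /J0_pi H : J0 (pi 'X_[g]) by apply: H; rewrite mcoeffX eqxx oner_eq0.
apply: rp; rewrite -rmorphM; apply/J0_pi => m /mcoeffM_neq0[m1 [m2 [-> /Hp[u uU Nu]]]].
rewrite mcoeffX; case: (_ =P _ :> 'X_{1..n}) => [<- _|_]; last by rewrite eqxx.
have -> : (m1 + g = g + U_(u) *+ N + (m1 - U_(u) *+ N))%MM.
  apply/mnmP => i; rewrite !mnmDE mnmBE mulmnE mnm1E.
  by case: eqP => [<-|_]; lia.
exact/S_add/HU.
Qed.

(* Multiplication by [X^g] on the terms involving [U1], and by [0] on the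
   others, is a homomorphism [phi] from the ideal of powers to the quotient.  A
   regular sequence of length two in that ideal forces [phi] to be the
   multiplication by an element [h / v], which would have [X^g]-coefficient both
   nonzero (because of [U1]) and zero (because of [U2]). *)
Lemma monomial_depth1 U1 U2 N g : (0 < N)%N -> [disjoint U1 & U2] ->
  (forall u1 u2, u1 \in U1 -> u2 \in U2 -> S (g + U_(u1) *+ N + U_(u2) *+ N)%MM) ->
  (exists2 u, u \in U1 & ~ S (g + U_(u) *+ N)%MM) ->
  (exists2 u, u \in U2 & ~ S (g + U_(u) *+ N)%MM) ->
  (#|U1| + #|U2| <= #|Cov|.+1)%N.
Proof.
move=> N0 dis HU [u1 u1U nS1] [u2 u2U nS2]; rewrite leqNgt; apply/negP => CU.
pose U := U1 :|: U2.
have cU : #|U| = (#|U1| + #|U2|)%N by rewrite cardsU (disjoint_setI0 dis) cards0 subn0.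
have [s [rs ss]] := CM_rseq.
have cUC : (#|~: U|.+1 < size s)%N.
  apply: leq_trans ss; have := cardsC U; rewrite card_ord cU; lia.
have [|p1 [s1 [Hp1 [Mb1 rb1 rs1] ss1]]] := rseq_meets_powers (U := U) N0 sJ0 rs.
  exact: ltnW.
have sJ1 : sat_ideal MP (ext MP J0 (pi p1)) by exact: (sat_ideal_ext MP1 MPprime _ sJ0).
have [|p2 [s2 [Hp2 [Mb2 rb2 _] _]]] := rseq_meets_powers (U := U) N0 sJ1 rs1.
  by move: cUC; rewrite -ss1.
pose T m := [exists u in U1, (N <= m u)%N].
(* [pr p] keeps the terms divisible by the [N]-th power of a variable in [U1]. *)
pose pr p := \sum_(m <- msupp p | T m) p@_m *: 'X_[m].
have prE p m : (pr p)@_m = if T m then p@_m else 0.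
  rewrite /pr big_mkcond raddf_sum /=.
  have [pm|pm] := boolP (m \in msupp p); last first.
    rewrite big1_seq /=; last first.
      move=> i im; case: ifP => _; last by rewrite mcoeff0.
      rewrite mcoeffZ mcoeffX; case: eqP => [e|]; last by rewrite mulr0.
      by rewrite -e im in pm.
    by rewrite (memN_msupp_eq0 pm) if_same.
  rewrite (bigD1_seq m) ?msupp_uniq //= big1 ?addr0.
    by case: ifP; rewrite ?mcoeff0 // mcoeffZ mcoeffX eqxx mulr1.
  move=> i im; case: ifP; rewrite ?mcoeff0 // mcoeffZ mcoeffX (negPf im) mulr0 //.
pose phi p := 'X_[g] * pr p.
have pr1 p : mon_ideal (powers U1 N) (pr p).
  move=> m; rewrite prE; case: ifP => [/existsP[u /andP[]] *|]; last by rewrite eqxx.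
  by exists u.
have pr2 p : mon_ideal (powers U N) p -> mon_ideal (powers U2 N) (p - pr p).
  move=> Hp m; rewrite mcoeffB prE; case: ifP => [_|/negbT/negP H]; first by rewrite subrr eqxx.
  rewrite subr0 => /Hp[u]; rewrite !inE => /orP[uU|uU] Nu; last by exists u.
  by case: H; rewrite /T; apply/existsP; exists u; rewrite uU.
have key p q : mon_ideal (powers U1 N) p -> mon_ideal (powers U2 N) q ->
    mon_ideal S ('X_[g] * (p * q)).
  move=> Hp Hq m /mcoeffM_neq0[m1 [m2 [-> +]]] /mcoeffM_neq0[m3 [m4 [->]]].
  rewrite mcoeffX; case: (_ =P _ :> 'X_{1..n}) => [<- _|_]; last by rewrite eqxx.
  move=> /Hp[v1 v1U Nv1] /Hq[v2 v2U Nv2].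
  have v12 : v1 != v2 by apply: contraTneq v2U => <-; rewrite (disjointFr dis).
  have -> : (g + (m3 + m4) = g + U_(v1) *+ N + U_(v2) *+ N
     + ((m3 - U_(v1) *+ N) + (m4 - U_(v2) *+ N)))%MM.
    apply/mnmP => i; rewrite !mnmDE !mnmBE !mulmnE !mnm1E.
    by case: eqP => [e1|_]; case: eqP => [e2|_]; subst; lia.
  exact/S_add/HU.
(* Linearity of [phi]: only products of a [U1] part with a [U2] part remain. *)
have comm p q : mon_ideal (powers U N) p -> mon_ideal (powers U N) q ->
    mon_ideal S (q * phi p - p * phi q).
  move=> Hp Hq.
  have -> : q * phi p - p * phi q
    = 'X_[g] * (pr p * (q - pr q)) - 'X_[g] * (pr q * (p - pr p)) by rewrite /phi; ring.
  by apply: mon_idealB; apply: key => //; apply: pr2.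
have [J00 JD JM JS] := sJ0.
(* [p2 * phi p1] agrees with [p1 * phi p2], and [p2] is regular modulo [p1], so [phi p1] is a
   multiple of [p1] up to a unit. *)
have [v [h [nv Jvh]]] : ext MP J0 (pi p1) (pi (phi p1)).
  apply: rb2; exists 1, (pi (phi p2)); split; first exact: MP1.
  by rewrite mul1r -!rmorphM -rmorphB; apply/J0_pi/comm.
have [V Vv] := pi_surj v; have [H Hh] := pi_surj h.
(* Cancelling the regular element [p1] extends [phi = h / v] to the whole ideal of powers. *)
have lin q : mon_ideal (powers U N) q -> mon_ideal S (V * phi q - H * q).
  move=> Hq; apply/J0_pi; rewrite rmorphB (rmorphM pi V) (rmorphM pi H) Vv Hh; apply: rb1.
  rewrite [X in J0 X](_ : _ = - v * (pi q * pi (phi p1) - pi p1 * pi (phi q))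
       + pi q * (v * pi (phi p1) - pi p1 * h)); last by ring.
  apply: JD; apply: (JM) => //.
  by rewrite -!rmorphM -rmorphB; apply/J0_pi/comm.
have pw u m : u \in U -> m = (U_(u) *+ N)%MM -> mon_ideal (powers U N) 'X_[m].
  move=> uU -> k; rewrite mcoeffX; case: (_ =P _ :> 'X_{1..n}) => [<- _|_]; last by rewrite eqxx.
  by exists u; rewrite // mulmnE mnm1E eqxx mul1n.
have V0 : V@_0%MM != 0 by move/negP: nv; rewrite -Vv mem_origin.
(* Compare coefficients at [g] times the [N]-th power of [u1], which is outside [S]. The same
   comparison at [u2], where [phi] vanishes, then gives the contradiction. *)
have Hg : H@_g = V@_0%MM.
  have := lin 'X_[U_(u1) *+ N] (pw u1 _ _ erefl).
  rewrite inE u1U => /(_ isT) /(_ (g + U_(u1) *+ N)%MM).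
  have -> : phi 'X_[U_(u1) *+ N] = 'X_[g] * 'X_[U_(u1) *+ N].
    congr (_ * _); apply/mpolyP => m; rewrite prE mcoeffX; case: eqP => [<-|_].
      case: ifP => // /existsP[]; exists u1.
      by rewrite u1U mulmnE mnm1E eqxx mul1n leqnn.
    by rewrite if_same.
  rewrite mulrA -mulrBl addmC mcoeffMX mcoeffB -{1}[g]addm0 mcoeffMX subr_eq0.
  have [->//|_ /(_ isT)] := eqVneq (V@_0%MM) (H@_g).
  by rewrite addmC => /nS1.
have := lin 'X_[U_(u2) *+ N] (pw u2 _ _ erefl).
rewrite inE u2U orbT => /(_ isT) /(_ (g + U_(u2) *+ N)%MM).
have -> : phi 'X_[U_(u2) *+ N] = 0.
  rewrite /phi; suff -> : pr 'X_[U_(u2) *+ N] = 0 by rewrite mulr0.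
  apply/mpolyP => m; rewrite prE mcoeffX mcoeff0; case: eqP => [<-|_]; last by rewrite if_same.
  case: ifP => // /existsP[u /andP[uU]]; rewrite mulmnE mnm1E.
  have -> : (u2 == u) = false by apply: contraTF uU => /eqP <-; rewrite (disjointFl dis).
  by rewrite mul0n leqNgt N0.
rewrite mulr0 sub0r mcoeffN addmC mcoeffMX oppr_eq0 Hg => /(_ V0).
by rewrite addmC => /nS2.
Qed.

End MonomialQuotient.

(** * Powers of weighted edge ideals *)

Lemma quotient_map (R : comNzRingType) (I : idealr R) :
  exists2 pi : {rmorphism R -> {ideal_quot I}},
    forall a, exists p, pi p = a & forall p, pi p = 0 <-> p \in I.
Proof.
exists (\pi_({ideal_quot I})%qT : {rmorphism R -> {ideal_quot I}}) => [a|p].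
  by exists (generic_quotient.repr a); apply: generic_quotient.reprK.
have := Quotient.idealrBE I p 0; rewrite subr0 => ->.
by split=> [H|/eqP]; [apply/eqP; rewrite rmorph0|rewrite rmorph0].
Qed.

Section PowersOfEdgeIdeals.
Variables (V : finType) (G : weighted_graph V) (K : fieldType).
Implicit Types (L : seq (V * V)) (e : V -> nat) (u v : V).

(** The exponent of [v] in the product of the generators attached to the edges listed in [L]. *)
Definition load L v : nat :=
  \sum_(l <- L) weight G l.1 l.2 * ((v == l.1) + (v == l.2)).

(** Divisibility by a product of [k] generators; by [ideal_powE] this describes the monomials of the
    [k]-th power of the edge ideal. *)
Definition in_power k e : Prop :=
  exists L, [/\ size L = k, all (fun l => edge G l.1 l.2) L & forall v, (load L v <= e v)%N].

Lemma load_cat L1 L2 v : load (L1 ++ L2) v = (load L1 v + load L2 v)%N.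
Proof. by rewrite /load big_cat. Qed.

Lemma load_cons l L v :
  load (l :: L) v = (weight G l.1 l.2 * ((v == l.1) + (v == l.2)) + load L v)%N.
Proof. by rewrite /load big_cons. Qed.

Lemma in_power_leq k e e' : (forall v, (e v <= e' v)%N) -> in_power k e -> in_power k e'.
Proof.
move=> H [L [sL aL HL]]; exists L; split=> // v; exact: leq_trans (H v).
Qed.

Lemma in_powerD k1 k2 e1 e2 e : (forall v, (e1 v + e2 v <= e v)%N) ->
  in_power k1 e1 -> in_power k2 e2 -> in_power (k1 + k2) e.
Proof.
move=> He [L1 [s1 a1 H1]] [L2 [s2 a2 H2]]; exists (L1 ++ L2).
rewrite size_cat s1 s2 all_cat a1 a2; split=> // v; rewrite load_cat.
by apply: leq_trans (He v); rewrite leq_add.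
Qed.

Local Notation mon_of := 'X_{1..#|V|}.

Definition power_mon k (m : mon_of) : Prop := in_power k (fun v => m (enum_rank v)).

Lemma power_mon_add k m m' : power_mon k m -> power_mon k (m + m')%MM.
Proof. by apply: in_power_leq => v; rewrite mnmDE leq_addr. Qed.

Lemma mon_ideal_powerM k1 k2 (p q : {mpoly K[#|V|]}) :
  mon_ideal (power_mon k1) p -> mon_ideal (power_mon k2) q ->
  mon_ideal (power_mon (k1 + k2)) (p * q).
Proof.
move=> Hp Hq m /mcoeffM_neq0[m1 [m2 [-> /Hp H1 /Hq H2]]].
by apply: in_powerD H1 H2 => v; rewrite mnmDE.
Qed.

Definition edge_mon u v : mon_of :=
  ((U_(enum_rank u) + U_(enum_rank v)) *+ weight G u v)%MM.

Lemma edge_monE u v :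
  (vertex_var K u * vertex_var K v) ^+ weight G u v = 'X_[edge_mon u v].
Proof. by rewrite /vertex_var -mpolyXD mpolyXn. Qed.

Lemma load_edge_mon L v :
  load L v = (\sum_(l <- L) edge_mon l.1 l.2)%MM (enum_rank v).
Proof.
rewrite mnm_sumE; apply: eq_bigr => l _; rewrite mulmnE mnmDE !mnm1E mulnC.
by rewrite !(inj_eq enum_rank_inj) !(eq_sym v).
Qed.

Lemma gen_ideal_gen (A : comNzRingType) (P : A -> Prop) x : P x -> gen_ideal P x.
Proof.
by move=> Px; exists 1%N, (fun=> 1), (fun=> x); split; rewrite // big_ord1 mul1r.
Qed.

Lemma gen_ideal0 (A : comNzRingType) (P : A -> Prop) : gen_ideal P 0.
Proof. by exists 0%N, (fun=> 0), (fun=> 0); split; [case|rewrite big_ord0]. Qed.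

Lemma gen_idealM (A : comNzRingType) (P : A -> Prop) x y :
  gen_ideal P x -> gen_ideal P (y * x).
Proof.
move=> [n [c [g [Hg ->]]]]; exists n, (fun i => y * c i), g; split=> //.
by rewrite mulr_sumr; apply: eq_bigr => i _; rewrite mulrA.
Qed.

Lemma gen_idealD (A : comNzRingType) (P : A -> Prop) x y :
  gen_ideal P x -> gen_ideal P y -> gen_ideal P (x + y).
Proof.
move=> [n [c [g [Hg ->]]]] [n' [c' [g' [Hg' ->]]]].
exists (n + n')%N, (fun i => match split i with inl j => c j | inr j => c' j end),
  (fun i => match split i with inl j => g j | inr j => g' j end); split.
  by move=> i; case: (split i).
rewrite big_split_ord /=; congr (_ + _); apply: eq_bigr => i _.
  by have /= -> := unsplitK (inl i : 'I_n + 'I_n').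
by have /= -> := unsplitK (inr i : 'I_n + 'I_n').
Qed.

Lemma edge_ideal_mon (p : {mpoly K[#|V|]}) :
  weighted_edge_ideal G p -> mon_ideal (power_mon 1) p.
Proof.
move=> [n [c [g [Hg ->]]]]; elim/big_ind: _ => [||i _].
- exact: mon_ideal0.
- by move=> *; apply: mon_idealD.
have [u [v [uv ->]]] := Hg i; rewrite edge_monE.
apply: mon_idealM => [m m'|m]; first exact: power_mon_add.
rewrite mcoeffX; case: (_ =P m) => [<- _|_]; last by rewrite eqxx.
exists [:: (u, v)]; split; rewrite //= ?uv // => x.
by rewrite load_edge_mon big_seq1.
Qed.

Lemma ideal_powE k (p : {mpoly K[#|V|]}) :
  ideal_pow (weighted_edge_ideal G (K := K)) k p <-> mon_ideal (power_mon k) p.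
Proof.
split=> [[n [c [g [Hg ->]]]]|Hp].
  elim/big_ind: _ => [||i _].
  - exact: mon_ideal0.
  - by move=> *; apply: mon_idealD.
  have [f [Hf ->]] := Hg i.
  apply: mon_idealM => [m m'|]; first exact: power_mon_add.
  elim: k f Hf {Hg} => [|k IH] f Hf.
    rewrite big_ord0 => m _; exists [::]; split=> // v.
    by rewrite /load big_nil.
  rewrite big_ord_recl; apply: (@mon_ideal_powerM 1 k); first exact/edge_ideal_mon/Hf.
  by apply: IH => j; apply: Hf.
rewrite [p]mpolyE big_seq; elim/big_ind: _ => [||m].
- exact: gen_ideal0.
- exact: gen_idealD.
rewrite mcoeff_msupp => /Hp[L [sL aL HL]].
pose M : mon_of := (\sum_(l <- L) edge_mon l.1 l.2)%MM.
have ME : m = (m - M + M)%MM.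
  rewrite submK //; apply/mnm_lepP => i; rewrite -(enum_valK i).
  by rewrite -load_edge_mon; apply: HL.
rewrite ME mpolyXD -mul_mpolyC mulrA; apply: gen_idealM.
apply: gen_ideal_gen; subst k.
exists (fun i => 'X_[edge_mon (tnth (in_tuple L) i).1 (tnth (in_tuple L) i).2]); split.
  move=> i; rewrite -edge_monE; apply: gen_ideal_gen.
  by do 2!eexists; split; [|reflexivity]; apply: (allP aL); apply: mem_tnth.
rewrite /M (big_tnth _ _ L).
exact: (big_morph (fun m => 'X_[m]) (mpolyXD K) (mpolyX0 _ K)).
Qed.

Variables (k : nat) (C : {set V}).
Hypothesis k_gt0 : (0 < k)%N.
Hypothesis k_CM : cohen_macaulay_ideal (ideal_pow (weighted_edge_ideal G (K := K)) k).
Hypothesis C_cover : forall u v, edge G u v -> (u \in C) || (v \in C).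

Definition raise e u N : V -> nat := fun v => (e v + N * (v == u))%N.

Let Cov := [set enum_rank v | v in C].

Lemma power_mon_cover m : power_mon k m -> meets Cov m.
Proof.
move=> [L [sL aL HL]]; case: L sL aL HL => [|[u v] L].
  by move=> k0; have := k_gt0; rewrite -k0.
move=> _ /andP[/= uv _] HL.
have w0 := weight_gt0 uv.
have [uC|uC] := boolP (u \in C).
  exists (enum_rank u); first exact: imset_f.
  by apply: leq_trans (HL u); rewrite load_cons /= eqxx; lia.
exists (enum_rank v); first by apply: imset_f; have := C_cover uv; rewrite (negPf uC).
by apply: leq_trans (HL v); rewrite load_cons /= eqxx; lia.
Qed.

Definition mon_exp e : mon_of := [multinom e (enum_val i) | i < #|V|].

Lemma power_mon_exp e : power_mon k (mon_exp e) <-> in_power k e.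
Proof. by split; apply: in_power_leq => v; rewrite mnmE enum_rankK. Qed.

Lemma mon_exp_raise e u N :
  mon_exp (raise e u N) = (mon_exp e + U_(enum_rank u) *+ N)%MM.
Proof.
apply/mnmP => i; rewrite mnmDE !mnmE /raise mulmnE mnm1E mulnC.
by rewrite -(inj_eq enum_val_inj) enum_rankK eq_sym.
Qed.

Let card_rank (U : {set V}) : #|[set enum_rank v | v in U]| = #|U|.
Proof. exact/card_imset/enum_rank_inj. Qed.

Lemma CM_quotient : exists (A : comNzRingType) (pi : {rmorphism {mpoly K[#|V|]} -> A}),
  [/\ forall a, exists p, pi p = a,
      forall p, pi p = 0 <-> mon_ideal (power_mon k) p & cohen_macaulay A].
Proof.
have [hI cmA] := k_CM.
have [pi pi_surj pi0] := quotient_map (ideal_pred hI).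
exists {ideal_quot (ideal_pred hI)}, pi; split=> // p.
by rewrite pi0 -ideal_powE; split=> /asboolP.
Qed.

Lemma power_depth0 (U : {set V}) N e : (0 < N)%N -> ~ in_power k e ->
  (forall u, u \in U -> in_power k (raise e u N)) -> (#|U| <= #|C|)%N.
Proof.
move=> N0 ne HU; have [A [pi [pi_surj pi0 cmA]]] := CM_quotient.
rewrite -card_rank -(card_rank C).
apply: (monomial_depth0 (@power_mon_add k) pi_surj pi0 power_mon_cover cmA
  (g := mon_exp e) N0); first by move/power_mon_exp.
by move=> _ /imsetP[u uU ->]; rewrite -mon_exp_raise; apply/power_mon_exp/HU.
Qed.

Lemma power_depth1 (U1 U2 : {set V}) N e : (0 < N)%N -> [disjoint U1 & U2] ->
  (forall u1 u2, u1 \in U1 -> u2 \in U2 -> in_power k (raise (raise e u1 N) u2 N)) ->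
  (exists2 u, u \in U1 & ~ in_power k (raise e u N)) ->
  (exists2 u, u \in U2 & ~ in_power k (raise e u N)) ->
  (#|U1| + #|U2| <= #|C|.+1)%N.
Proof.
move=> N0 dis HU [u1 u1U n1] [u2 u2U n2].
have [A [pi [pi_surj pi0 cmA]]] := CM_quotient.
rewrite -(card_rank U1) -(card_rank U2) -(card_rank C).
apply: (monomial_depth1 (@power_mon_add k) pi_surj pi0 power_mon_cover cmA
  (g := mon_exp e) N0).
- by rewrite -setI_eq0 -imsetI ?(disjoint_setI0 dis) ?imset0 // => ? ? _ _ /enum_rank_inj.
- move=> _ _ /imsetP[v1 v1U ->] /imsetP[v2 v2U ->].
  by rewrite -!mon_exp_raise; apply/power_mon_exp/HU.
- by exists (enum_rank u1); [apply: imset_f|rewrite -mon_exp_raise => /power_mon_exp].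
- by exists (enum_rank u2); [apply: imset_f|rewrite -mon_exp_raise => /power_mon_exp].
Qed.

End PowersOfEdgeIdeals.

(** * Trees *)

Section CohenMacaulayTrees.
Local Open Scope nat_scope.
Variables (V : finType) (G : weighted_graph V) (K : fieldType).
Hypothesis acyclic : forall c : seq V, ucycle (edge G) c -> size c <= 2.
Hypothesis connectedG : forall u v, connect (edge G) u v.
Hypothesis CM : forall n, 1 <= n ->
  cohen_macaulay_ideal (ideal_pow (weighted_edge_ideal G (K := K)) n).
Implicit Types (S T X Z : {set V}) (u v x y z : V) (e : V -> nat).
Local Notation adj := (edge G).
Local Notation w := (weight G).

Lemma adjC u v : adj u v = adj v u. Proof. exact: edge_sym. Qed.
Lemma adj_neq u v : adj u v -> u != v.
Proof. by apply: contraTneq => ->; rewrite edge_irrefl. Qed.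

Lemma no_triangle x y z : adj x y -> adj y z -> adj x z = false.
Proof.
move=> xy yz; apply/negP => xz.
suff /acyclic : ucycle adj [:: x; y; z] by [].
rewrite /ucycle /= xy yz (adjC z) xz !inE negb_or.
by rewrite (adj_neq xy) (adj_neq xz) (adj_neq yz).
Qed.

(** * Independent sets and membership in powers *)

Definition indep S := [forall u in S, forall v in S, ~~ adj u v].

Lemma indepP S : reflect (forall u v, u \in S -> v \in S -> adj u v = false) (indep S).
Proof.
apply: (iffP forall_inP) => [H u v uS vS|H u uS].
  by apply: negbTE; have /forall_inP := H u uS; apply.
by apply/forall_inP => v vS; rewrite H.
Qed.

Definition dominates S T := forall v, v \in T -> v \notin S -> exists2 s, s \in S & adj v s.

Lemma indep_extend S T : S \subset T -> indep S ->
  exists S', [/\ S \subset S', S' \subset T, indep S' & dominates S' T].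
Proof.
move=> ST iS.
have [S' /maxsetP[/andP[iS' S'T] S'max] SS'] :=
  @maxset_exists _ (fun S => indep S && (S \subset T)) S (introT andP (conj iS ST)).
exists S'; split=> // v vT vS'; apply: contrapT => Hv; move/negP: vS'; apply.
have nv s : s \in S' -> adj v s = false.
  by move=> sS'; apply/negP => vs; apply: Hv; exists s.
suff <- : v |: S' = S' by apply: setU11.
apply: S'max; last exact: subsetUr.
rewrite subUset sub1set vT S'T !andbT; apply/indepP => a b.
rewrite !inE => /orP[/eqP->|aS] /orP[/eqP->|bS]; rewrite ?edge_irrefl ?nv //.
  by rewrite adjC nv.
by move/indepP: iS'; apply.
Qed.

(** A crude common bound on the weights, used to build sufficiently large exponents. *)
Definition total_weight := \sum_u \sum_v w u v.

Lemma leq_total_weight u v : w u v <= total_weight.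
Proof. by rewrite /total_weight (bigD1 u) //= (bigD1 v) //= -addnA leq_addr. Qed.

Lemma load_nseq a u v x : load G (nseq a (u, v)) x = a * (w u v * ((x == u) + (x == v))).
Proof.
elim: a => [|a IH]; first by rewrite /load big_nil.
by rewrite /= load_cons IH mulSn.
Qed.

Lemma in_power_nseq2 a b u v u' v' e : adj u v -> adj u' v' ->
  (forall x, a * (w u v * ((x == u) + (x == v))) + b * (w u' v' * ((x == u') + (x == v')))
     <= e x) -> in_power G (a + b) e.
Proof.
move=> uv uv' H; exists (nseq a (u, v) ++ nseq b (u', v')); split.
- by rewrite size_cat !size_nseq.
- by rewrite all_cat !all_nseq /= uv uv' !orbT.
- by move=> x; rewrite load_cat !load_nseq.
Qed.

Lemma in_power_nseq a u v e : adj u v ->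
  (forall x, a * (w u v * ((x == u) + (x == v))) <= e x) -> in_power G a e.
Proof.
move=> uv H; rewrite -[a]addn0; apply: (in_power_nseq2 uv uv) => x.
by rewrite mul0n addn0.
Qed.

(** As weights are positive, every edge of a product dividing the monomial joins vertices of the
    support of [e]. Only the multiplicities [c] on [E] matter, so membership yields linear
    inequalities. *)
Lemma in_power_counts k e (E : seq (V * V)) : in_power G k e -> uniq E ->
  (forall u v, adj u v -> 0 < e u -> 0 < e v -> ((u, v) \in E) || ((v, u) \in E)) ->
  exists c : V * V -> nat, k = \sum_(l <- E) c l /\
    forall x, \sum_(l <- E) c l * (w l.1 l.2 * ((x == l.1) + (x == l.2))) <= e x.
Proof.
move=> [L [<- aL HL]] uE HE.
have {}HE l : l \in L -> (l \in E) || ((l.2, l.1) \in E).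
  case: l => u v lL; have uv : adj u v by apply: (allP aL _ lL).
  have w0 := weight_gt0 uv.
  have pos x : (x == u) || (x == v) -> 0 < e x.
    move=> H; apply: leq_trans (HL x); rewrite /load (big_rem _ lL) /= addn_gt0.
    by rewrite muln_gt0 w0 addn_gt0 !lt0b H.
  by apply: HE => //; apply: pos; rewrite eqxx ?orbT.
have [c [cs cl]] : exists c : V * V -> nat, size L = \sum_(l <- E) c l /\
    forall x, load G L x = \sum_(l <- E) c l * (w l.1 l.2 * ((x == l.1) + (x == l.2))).
  elim: L aL HE {HL} => [|l L IH] aL HE.
    exists (fun=> 0); split; first by rewrite big1.
    by move=> x; rewrite /load big_nil big1.
  have /andP[ladj aL'] := aL.
  have [c [cs cl]] := IH aL' (fun l' h => HE l' (mem_behead (s := l :: L) h)).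
  (* [l0] is the edge [l] in the orientation listed in [E]. *)
  have [l0 l0E l0w] : exists2 l0, l0 \in E & forall x,
      w l0.1 l0.2 * ((x == l0.1) + (x == l0.2)) = w l.1 l.2 * ((x == l.1) + (x == l.2)).
    have /orP[lE|lE] := HE l (mem_head _ _); first by exists l.
    by exists (l.2, l.1) => //= x; rewrite addnC weight_sym // adjC.
  exists (fun l' => (l' == l0) + c l'); split.
    rewrite big_split /= -cs (bigD1_seq l0) //= eqxx big1 // => l' /negbTE -> //.
  move=> x; rewrite load_cons cl -l0w.
  under [RHS]eq_bigr do rewrite mulnDl.
  rewrite big_split /=; congr (_ + _).
  by rewrite (bigD1_seq l0) //= eqxx mul1n big1 ?addn0 // => l' /negbTE ->.
by exists c; split=> // x; rewrite -cl.
Qed.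

(** The product of large powers of the vertices of [S] is outside the edge ideal by independence,
    but a large power of any other vertex brings it in by domination. So [power_depth0] compares the
    complements of [S] and [S']. *)
Lemma well_covered S S' : indep S -> dominates S setT -> indep S' -> #|S'| <= #|S|.
Proof.
move=> iS dS iS'.
have cov u v : adj u v -> (u \in ~: S') || (v \in ~: S').
  move=> uv; rewrite !inE -negb_and; apply/negP => /andP[uS vS].
  by move/indepP: iS' => /(_ u v uS vS); rewrite uv.
pose N := total_weight.+1.
pose e v := N * (v \in S).
suff : #|~: S| <= #|~: S'| by have := cardsC S; have := cardsC S'; lia.
apply: (power_depth0 (ltn0Sn 0) (CM (ltn0Sn 0)) cov (e := e) (ltn0Sn total_weight)).
  move=> [L [sL aL HL]]; case: L sL aL HL => [|[u v] [|? ?]] //= _ /andP[uv _] HL.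
  have w0 := weight_gt0 uv.
  have uS : u \in S.
    have := HL u; rewrite load_cons /= eqxx /e; case: (u \in S) => //; nia.
  have vS : v \in S.
    have := HL v; rewrite load_cons /= eqxx /e; case: (v \in S) => //; nia.
  by move/indepP: iS => /(_ u v uS vS); rewrite uv.
move=> u; rewrite inE => uS; have [s sS us] := dS u (in_setT _) uS.
apply: (in_power_nseq us) => x; rewrite /raise /e /N.
have := leq_total_weight u s.
have [->|] := eqVneq x s; first by rewrite sS; case: (s == u); nia.
by move=> _; case: (x == u); case: (x \in S); nia.
Qed.

(** * Leaves and the matching *)

Definition is_leaf v := #|[set u | adj v u]| == 1.

Lemma leafP v u : is_leaf v -> adj v u -> forall x, adj v x -> x = u.
Proof.
move=> /cards1P[a Ha] vu x vx.
have := Ha; move/setP => H; have := H u; have := H x.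
by rewrite !inE vu vx => /esym/eqP-> /esym/eqP->.
Qed.

(** In a maximal independent set containing [x], replacing [x] by two leaves would give a larger
    independent set. *)
Lemma leaf_unique x y1 y2 : is_leaf y1 -> is_leaf y2 -> adj x y1 -> adj x y2 -> y1 = y2.
Proof.
move=> l1 l2 xy1 xy2; apply/eqP/negP => /negP y12.
have n1 := leafP l1 (etrans (adjC _ _) xy1).
have n2 := leafP l2 (etrans (adjC _ _) xy2).
have ix : indep [set x].
  by apply/indepP => a b; rewrite !inE => /eqP-> /eqP->; rewrite edge_irrefl.
have [S [xS _ iS dS]] := indep_extend (subsetT _) ix.
rewrite sub1set in xS.
have y1S : y1 \notin S by apply/negP => H; move/indepP: iS => /(_ _ _ xS H); rewrite xy1.
have y2S : y2 \notin S by apply/negP => H; move/indepP: iS => /(_ _ _ xS H); rewrite xy2.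
suff /(well_covered iS dS) : indep (y1 |: (y2 |: (S :\ x))).
  rewrite !cardsU1 !inE (negPf y12) (negPf y1S) (negPf y2S) !andbF /=.
  by have := cardsD1 x S; rewrite xS; lia.
have nx a b : a != x -> b != x -> (a == y1) || (a == y2) -> adj a b = false.
  by move=> ax bx /orP[] /eqP aE; subst a; apply/negP; [move/n1|move/n2] => H;
    rewrite H eqxx in bx.
have x1 : y1 != x by rewrite eq_sym adj_neq.
have x2 : y2 != x by rewrite eq_sym adj_neq.
apply/indepP => a b; rewrite !inE => Ha Hb.
have ax : a != x by case/or3P: Ha => [/eqP->|/eqP->|/andP[]].
have bx : b != x by case/or3P: Hb => [/eqP->|/eqP->|/andP[]].
have [|Ha'] := boolP ((a == y1) || (a == y2)); first exact: nx.
have [|Hb'] := boolP ((b == y1) || (b == y2)); first by rewrite adjC; apply: nx.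
move: Ha Hb Ha' Hb'; rewrite !negb_or => Ha Hb /andP[/negPf a1 /negPf a2].
move=> /andP[/negPf b1 /negPf b2]; move: Ha Hb; rewrite a1 a2 b1 b2 /=.
by move=> /andP[_ aS] /andP[_ bS]; move/indepP: iS; apply.
Qed.

(* If [x] had no leaf neighbour, let [S] be a maximal independent set containing
   [x] and all vertices at distance two, [T] a branch at [x] and [T'] the union
   of the other branches.  Exchanging [S] inside [T] and [T'] for sets [Q1] and
   [Q2] containing neighbours of [x] gives maximal independent sets of
   incompatible sizes. *)
Lemma leaf_exists x u1 : adj x u1 -> ~~ is_leaf x -> exists2 y, is_leaf y & adj x y.
Proof.
move=> xu1 nlx; apply: contrapT => noleaf.
have another u v : adj u v -> ~~ is_leaf u -> exists2 t, adj u t & t != v.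
  move=> uv nlu; apply: contrapT => H; move/negP: nlu; apply; apply/cards1P.
  exists v; apply/setP => t; rewrite !inE; apply/idP/eqP => [ut|->//].
  by apply/eqP/negP => /negP tv; apply: H; exists t.
have [u2 xu2 u21] := another x u1 xu1 nlx.
pose W := [set v | (v != x) && [exists u, adj x u && adj u v]].
have WP v : v \in W -> exists u, [/\ v != x, adj x u & adj u v].
  by rewrite inE => /andP[vx /existsP[u /andP[]]]; exists u.
have iW : indep (x |: W).
  have xW v : v \in W -> adj x v = false.
    by move=> /WP[u [_ xu uv]]; apply: (no_triangle xu).
  have WW a b : a \in W -> b \in W -> adj a b = false.
    move=> /WP[u [ax xu ua]] /WP[u' [bx xu' u'b]]; apply/negP => ab.
    have [uu'|uu'] := eqVneq u u'.
      by subst u'; have := no_triangle ua ab; rewrite u'b.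
    have au' : a != u'.
      by apply: contraTneq xu' => <-; rewrite (no_triangle xu ua).
    have bu : b != u.
      by apply: contraTneq xu => <-; rewrite (no_triangle xu' u'b).
    suff /acyclic : ucycle adj [:: x; u; a; b; u'] by [].
    rewrite /ucycle /= xu ua ab (adjC b) u'b (adjC u') xu' /= !inE !negb_or.
    rewrite (adj_neq xu) (adj_neq xu') (eq_sym x) ax (eq_sym x) bx (adj_neq ua).
    by rewrite (eq_sym u) bu uu' (adj_neq ab) au' (eq_sym b) (adj_neq u'b).
  apply/indepP => a b; rewrite !in_setU1 => /orP[/eqP->|aW] /orP[/eqP->|bW].
  - by rewrite edge_irrefl.
  - exact: xW.
  - by rewrite adjC; apply: xW.
  - exact: WW.
have [S [xWS _ iS dS]] := indep_extend (subsetT _) iW.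
have xS : x \in S by apply: (subsetP xWS); rewrite setU11.
(* [T] is the component of [u1] after deleting [x]; it misses [u2], since a path between them
   avoiding [x] would close to a cycle through [x]. *)
pose r := [rel a b | [&& adj a b, a != x & b != x]].
pose T := [set v | connect r u1 v].
have u1x : u1 != x by rewrite eq_sym adj_neq.
have u2x : u2 != x by rewrite eq_sym adj_neq.
have pathx p a : a != x -> path r a p -> x \notin a :: p.
  elim: p a => [|b p IH] a ax /=; first by rewrite inE eq_sym ax.
  by move=> /andP[/and3P[_ _ bx] /IH-/(_ bx)]; rewrite [in X in _ -> X]inE eq_sym (negPf ax).
have xT : x \notin T.
  rewrite inE; apply/negP => /connectP[p /(pathx _ _ u1x) xp xE].
  by rewrite xE mem_last in xp.
have u1T : u1 \in T by rewrite inE connect0.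
have u2T : u2 \notin T.
  rewrite inE; apply/negP => /connectP[p pp pE].
  have := pE; case/shortenP: pp => p' pp' up' _ u2E.
  suff /acyclic /= : ucycle adj (x :: u1 :: p').
    case: p' u2E {pp' up'} => //= u2E; by rewrite u2E eqxx in u21.
  have xp' := pathx _ _ u1x pp'.
  rewrite /ucycle cons_uniq xp' up' /= xu1 rcons_path -u2E (adjC u2) xu2 !andbT.
  by apply: sub_path pp' => a b /and3P[].
pose T' := ~: T :\ x.
have memT' a : (a \in T') = (a != x) && (a \notin T) by rewrite in_setD1 in_setC.
have TT' a b : a \in T -> b \in T' -> adj a b = false.
  move=> aT; have ax : a != x by apply: contraNneq xT => <-.
  move: aT; rewrite !inE => aT /andP[bx /negP bT]; apply/negP => ab; apply: bT.
  by apply: connect_trans aT (connect1 _); rewrite /= ab bx andbT.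
have combine (A B : {set V}) : A \subset T -> B \subset T' -> indep A -> indep B ->
    dominates A T -> dominates B T' -> (u1 \in A) || (u2 \in B) ->
    [/\ indep (A :|: B), dominates (A :|: B) setT & #|A :|: B| = #|A| + #|B|].
  move=> AT BT iA iB dA dB uAB; split.
  - apply/indepP => a b; rewrite !inE => /orP[aA|aB] /orP[bA|bB].
    + by move/indepP: iA; apply.
    + by apply: TT'; [apply: (subsetP AT)|apply: (subsetP BT)].
    + by rewrite adjC; apply: TT'; [apply: (subsetP AT)|apply: (subsetP BT)].
    + by move/indepP: iB; apply.
  - move=> v _; rewrite inE negb_or => /andP[vA vB].
    have [vx|vx] := eqVneq v x.
      by case/orP: uAB => [uA|uB]; [exists u1|exists u2]; rewrite ?inE ?uA ?uB ?orbT ?vx.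
    have [vT|vT] := boolP (v \in T).
      by have [s sA vs] := dA v vT vA; exists s; rewrite // inE sA.
    have [|s sB vs] := dB v _ vB; first by rewrite memT' vx.
    by exists s; rewrite // inE sB orbT.
  - rewrite cardsU; suff -> : A :&: B = set0 by rewrite cards0 subn0.
    apply/setP => a; rewrite !inE; apply/negP => /andP[/(subsetP AT) aT /(subsetP BT)].
    by rewrite memT' aT andbF.
(* A neighbour [v] of [x] is not a leaf; its other neighbour [t] is at distance two from [x], hence
   in [S], and dominates [v] in place of [x]. *)
have domS (P : {set V}) : x \notin P ->
    (forall a b, a \in P -> b != x -> adj a b -> b \in P) -> dominates (S :&: P) P.
  move=> xP clP v vP; rewrite inE vP andbT => vS.
  have vx : v != x by apply: contraNneq xP => <-.
  have [s sS vs] := dS v (in_setT _) vS.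
  have [sx|sx] := eqVneq s x; last first.
    by exists s; rewrite // inE sS; apply: clP vs.
  have xv : adj x v by rewrite adjC -sx.
  have nlv : ~~ is_leaf v by apply/negP => lv; apply: noleaf; exists v.
  have [t vt tx] := another v x (etrans (adjC _ _) xv) nlv.
  have tS : t \in S.
    apply: (subsetP xWS); rewrite !inE tx /=; apply/orP; right.
    by apply/existsP; exists v; rewrite xv vt.
  by exists t; rewrite // inE tS; apply: clP vt.
have clT a b : a \in T -> b != x -> adj a b -> b \in T.
  move=> aT bx ab; apply: contraT => bT.
  by rewrite (TT' a b aT) // in ab; rewrite memT' bx.
have clT' a b : a \in T' -> b != x -> adj a b -> b \in T'.
  move=> aT bx ab; rewrite memT' bx; apply/negP => bT.
  by rewrite adjC (TT' b a) in ab.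
have xT' : x \notin T' by rewrite memT' eqxx.
have ind1 a : indep [set a].
  by apply/indepP => b c; rewrite !inE => /eqP-> /eqP->; rewrite edge_irrefl.
have [Q1 [u1Q Q1T iQ1 dQ1]] : exists S', [/\ [set u1] \subset S', S' \subset T,
    indep S' & dominates S' T] by apply: indep_extend; rewrite ?sub1set.
have [Q2 [u2Q Q2T iQ2 dQ2]] : exists S', [/\ [set u2] \subset S', S' \subset T',
    indep S' & dominates S' T'].
  by apply: indep_extend => //; rewrite sub1set memT' u2x u2T.
rewrite !sub1set in u1Q u2Q.
have indI P : indep (S :&: P).
  by apply/indepP => a b; rewrite !inE => /andP[aS _] /andP[bS _]; move/indepP: iS; apply.
have d1 := domS T xT clT; have d2 := domS T' xT' clT'.
have [i12 e12 c12] := combine Q1 Q2 Q1T Q2T iQ1 iQ2 dQ1 dQ2 (introT orP (or_introl u1Q)).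
have [i1 e1 c1] := combine _ _ Q1T (subsetIr S T') iQ1 (indI T') dQ1 d2
  (introT orP (or_introl u1Q)).
have [i2 e2 c2] := combine _ _ (subsetIr S T) Q2T (indI T) iQ2 d1 dQ2
  (introT orP (or_intror u2Q)).
have cS : #|S| = #|S :&: T| + #|S :&: T'| + 1.
  rewrite (cardsD1 x S) xS addnC; congr (_ + 1).
  rewrite -(cardsID T (S :\ x)); congr (_ + _); apply: eq_card => a;
    rewrite !(memT', in_setI, in_setD, in_set1).
    by have [->|//] := eqVneq a x; rewrite (negPf xT) !andbF.
  by case: (a != x); case: (a \in S); case: (a \in T).
(* All four sets have the same size, so [q1 = s1] and [q2 = s2], while also
   [q1 + q2 = s1 + s2 + 1]. *)
have := well_covered i12 e12 i1; have := well_covered i1 e1 i12.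
have := well_covered i12 e12 i2; have := well_covered i2 e2 i12.
have := well_covered i12 e12 iS; have := well_covered iS dS i12.
rewrite c12 c1 c2 cS.
by move: #|Q1| #|Q2| #|S :&: T| #|S :&: T'| => q1 q2 s1 s2; clear; lia.
Qed.


Hypothesis nontrivial : exists u v, adj u v.

Lemma adjacent_leaves u v : adj u v -> is_leaf u -> is_leaf v -> forall x, (x == u) || (x == v).
Proof.
move=> uv lu lv x; have /connectP[p pp ->] := connectedG u x.
suff H q a : (a == u) || (a == v) -> path adj a q ->
    (last a q == u) || (last a q == v) by apply: H pp; rewrite eqxx.
elim: q a => //= b q IH a ha /andP[ab]; apply: IH.
case/orP: ha => /eqP aE; rewrite {}aE in ab.
  by rewrite (leafP lu uv ab) eqxx orbT.
by rewrite adjC in uv; rewrite (leafP lv uv ab) eqxx.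
Qed.

Lemma has_neighbor v : exists u, adj v u.
Proof.
have [a [b ab]] := nontrivial.
have [x xv] : exists x, x != v.
  have [av|] := eqVneq a v; last by exists a.
  by exists b; rewrite -av eq_sym adj_neq.
have /connectP[[|u p] /=] := connectedG v x; last by move=> /andP[vu _] _; exists u.
by move=> _ xE; rewrite xE eqxx in xv.
Qed.

(** [X] consists of the non-leaves, each matched with its only leaf neighbour. If all vertices are
    leaves, the tree is a single edge and either end may serve. *)
Lemma leaf_matching : exists (X : {set V}) (f : V -> V),
  [/\ forall x, x \in X -> adj x (f x), forall x, x \in X -> f x \notin X,
      forall x u, x \in X -> adj (f x) u -> u = x
    & forall v, v \notin X -> exists2 x, x \in X & v = f x].
Proof.
have [/existsP[v0 nv0]|/existsPn allleaf] := boolP [exists v, ~~ is_leaf v].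
  pose X := [set v | ~~ is_leaf v].
  pose f v := odflt v [pick y | is_leaf y && adj v y].
  have fP x : x \in X -> is_leaf (f x) /\ adj x (f x).
    rewrite inE /f => nx; have [u xu] := has_neighbor x.
    have [y ly xy] := leaf_exists xu nx.
    by case: pickP => [z /andP[]//|/(_ y)]; rewrite ly xy.
  exists X, f; split=> [x /fP[]//|x /fP[lf _]|x u xX|v].
  - by rewrite inE lf.
  - have [lf xf] := fP x xX; rewrite adjC in xf; exact: (leafP lf xf).
  - rewrite inE negbK => lv; have [x vx] := has_neighbor v.
    have nx : ~~ is_leaf x.
      apply/negP => lx; move/negP: nv0; apply.
      by case/orP: (adjacent_leaves vx lv lx v0) => /eqP->.
    exists x; first by rewrite inE.
    have [|lf xf] := fP x; first by rewrite inE.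
    by rewrite adjC in vx; apply: leaf_unique xf.
have leaf v : is_leaf v by have := allleaf v; rewrite negbK.
have [u [v uv]] := nontrivial.
exists [set u], (fun=> v); split=> [x|x _|x t|t].
- by rewrite inE => /eqP->.
- by rewrite inE eq_sym adj_neq.
- by rewrite inE => /eqP->; rewrite adjC in uv; apply: (leafP (leaf v) uv).
- rewrite inE => tu; exists u; first by rewrite inE.
  by have := adjacent_leaves uv (leaf u) (leaf v) t; rewrite (negPf tu) => /eqP.
Qed.

(** * Numerical conditions on the weights *)

Variables (X : {set V}) (f : V -> V).
Hypothesis f_adj : forall x, x \in X -> adj x (f x).
Hypothesis f_notin : forall x, x \in X -> f x \notin X.
Hypothesis f_leaf : forall x u, x \in X -> adj (f x) u -> u = x.
Hypothesis X_cover : forall v, v \notin X -> exists2 x, x \in X & v = f x.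

Lemma f_inj : {in X &, injective f}.
Proof.
move=> x x' xX x'X ff; apply: (f_leaf x'X); rewrite -ff adjC; exact: f_adj.
Qed.

Lemma vertex_coverX u v : adj u v -> (u \in X) || (v \in X).
Proof.
move=> uv; have [//|/X_cover[x xX uE]] := boolP (u \in X).
by rewrite uE in uv; rewrite (f_leaf xX uv).
Qed.

Lemma f_neq x x' : x \in X -> x' \in X -> (f x == x' = false) * (x' == f x = false).
Proof.
move=> xX x'X; have H : f x != x' by apply: contraTneq x'X => <-; apply: f_notin.
by rewrite [x' == _]eq_sym (negPf H).
Qed.

Lemma f_adjE x u : x \in X -> (adj (f x) u = (u == x)) * (adj u (f x) = (u == x)).
Proof.
move=> xX; rewrite [adj u _]adjC; suff -> : adj (f x) u = (u == x) by [].
by apply/idP/eqP => [/(f_leaf xX)//|->]; rewrite adjC f_adj.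
Qed.

(* Add large powers of as many variables as possible while staying outside the
   power: the remaining variables form a vertex cover containing both [x] and
   [f x], hence larger than the minimum [X]. *)
Lemma no_matched_pair k e x : 0 < k -> x \in X -> ~ in_power G k e ->
  (exists N, in_power G k (raise e x N)) ->
  (exists N, in_power G k (raise e (f x) N)) -> False.
Proof.
move=> k0 xX ne [N1 H1] [N2 H2].
pose P Z := `[< forall N, ~ in_power G k (fun v => e v + N * (v \in Z)) >].
have P0 : P set0.
  by apply/asboolP => N; apply: contra_not ne; apply: in_power_leq => v; rewrite inE muln0 addn0.
have [Z /maxsetP[/asboolP PZ maxZ] _] := maxset_exists P0.
have /choice[F HF] u : exists N, u \notin Z ->
    in_power G k (fun v => e v + N * (v \in u |: Z)).
  have [uZ|uZ] := boolP (u \in Z); first by exists 0.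
  suff /asboolPn/existsNP[N /contrapT HN] : ~~ P (u |: Z) by exists N.
  by apply: contra uZ => /maxZ/(_ (subsetUr _ _)) <-; apply: setU11.
pose N := (k * total_weight * 2 + \sum_u F u).+1.
pose e' v := e v + N * (v \in Z).
have Zin : x \notin Z.
  apply/negP => xZ; apply: (PZ N1); apply: in_power_leq H1 => v; rewrite /raise.
  by rewrite leq_add2l leq_mul2l; have [->|_] := eqVneq v x; rewrite ?xZ ?orbT.
have Zfin : f x \notin Z.
  apply/negP => xZ; apply: (PZ N2); apply: in_power_leq H2 => v; rewrite /raise.
  by rewrite leq_add2l leq_mul2l; have [->|_] := eqVneq v (f x); rewrite ?xZ ?orbT.
have Zindep u v : adj u v -> u \in Z -> v \in Z -> False.
  move=> uv uZ vZ; apply: (PZ N); apply: (in_power_nseq uv) => t.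
  have bt : (t == u) + (t == v) <= 2 * (t \in Z).
    have [->|_] := eqVneq t u; first by rewrite uZ; case: (_ == _).
    by have [->|_] := eqVneq t v; rewrite ?vZ.
  apply: leq_trans (leq_addl _ _); apply: (@leq_trans (k * (total_weight * (2 * (t \in Z))))).
    by rewrite leq_mul2l leq_mul ?orbT ?leq_total_weight.
  by rewrite /N !mulnA leq_mul2r ltnW ?orbT // ltnS leq_addr.
have := power_depth0 (U := ~: Z) k0 (CM k0) vertex_coverX (ltn0Sn _) (PZ N).
have H u : u \in ~: Z -> in_power G k (raise e' u N).
  rewrite inE => uZ; apply: in_power_leq (HF u uZ) => v; rewrite /raise /e' -addnA leq_add2l.
  have FN : F u <= N by rewrite /N (bigD1 u) //=; lia.
  by rewrite !inE; case: (v == u); case: (v \in Z); lia.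
move=> /(_ _ H); apply/negP; rewrite -ltnNge.
(* [Z] is independent, so [h] selects from each matched pair an end outside [Z]; the unselected
   [f x] makes the complement of [Z] larger than [X]. *)
pose h v := if v \in Z then f v else v.
have hinj : {in X &, injective h}.
  move=> a b aX bX; rewrite /h; case: ifP => _; case: ifP => _ //.
  - exact: f_inj.
  - by move/eqP; rewrite f_neq.
  - by move/eqP; rewrite f_neq.
rewrite -(card_in_imset hinj).
have fxh : f x \notin h @: X.
  apply/imsetP => [[a aX]]; rewrite /h; case: ifP => aZ.
    by move/(f_inj xX aX) => xa; rewrite xa aZ in Zin.
  by move/eqP; rewrite f_neq.
apply: leq_trans (_ : #|f x |: h @: X| <= _); first by rewrite cardsU1 fxh.
apply: subset_leq_card; apply/subsetP => a; rewrite in_setU1 inE => /orP[/eqP->//|].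
case/imsetP=> b bX ->; rewrite /h; case: ifP => [bZ|/negbT//].
by apply/negP => fbZ; apply: (Zindep _ _ (f_adj bX)).
Qed.

Local Notation m x := (w x (f x)).

Lemma m_gt0 x : x \in X -> 0 < m x.
Proof. by move=> /f_adj /weight_gt0. Qed.

(** Raising [x1] makes room for two copies of [x1 x2], and raising [f x1] for both matching edges.
    Unraised, [m x1] is too small for two copies of [x1 x2], and one copy of [x2 f(x2)] exhausts
    [x2]. *)
Lemma mixed_bound x1 x2 : x1 \in X -> x2 \in X -> adj x1 x2 ->
  m x1 < 2 * w x1 x2 -> 2 * w x1 x2 <= m x2 -> False.
Proof.
move=> X1 X2 x12 lt1 le2.
have n12 := negPf (adj_neq x12).
have m1 := m_gt0 X1; have m2 := m_gt0 X2; have w0 := weight_gt0 x12.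
pose e v := m x1 * (v == x1) + m x2 * (v == x2) + m x2 * (v == f x2).
apply: (@no_matched_pair 2 e x1) => //.
- move/in_power_counts => /(_ [:: (x1, x2); (x2, f x2)])[].
  + by rewrite /= !inE xpair_eqE n12.
  + have supp u : 0 < e u -> u \in [:: x1; x2; f x2].
      by apply: contraTT; rewrite !inE !negb_or => /and3P[/negPf a /negPf b /negPf c];
        rewrite /e a b c !muln0.
    move=> u v + /supp + /supp; rewrite !inE => uv /or3P[] /eqP uE /or3P[] /eqP vE;
      move: uv; rewrite uE vE ?edge_irrefl ?(f_adjE _ X2) ?n12 //;
      by rewrite !xpair_eqE !eqxx ?orbT.
  move=> c []; rewrite !big_cons big_nil /= => c2 H.
  move: (H x1) (H x2) (H (f x2)); rewrite !big_cons !big_nil /e /= {H}.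
  rewrite !eqxx (eq_sym x2 x1) n12 !f_neq //.
  move: c2 lt1 le2 m1 m2 w0; move: (c (x1, x2)) (c (x2, f x2)) => a b.
  move: (w x1 x2) (m x1) (m x2) => w1 w2 w3; clear.
  rewrite ?(muln0, muln1, addn0, add0n).
  by case: a => [|[|[|a]]]; case: b => [|[|[|b]]] //; lia.
- exists (2 * w x1 x2); apply: (in_power_nseq x12) => v.
  by rewrite /raise /e; case: (v == x1); case: (v == x2); case: (v == f x2); lia.
- exists (m x1); apply: (@in_power_nseq2 1 1 x1 (f x1) x2 (f x2)); try exact: f_adj.
  by move=> v; rewrite /raise /e; lia.
Qed.


Lemma in_power_large k u v e : adj u v -> k * total_weight <= e u ->
  k * total_weight <= e v -> in_power G k e.
Proof.
move=> uv eu ev; have := adj_neq uv; have le_w := leq_total_weight u v.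
have kw : k * w u v <= k * total_weight by rewrite leq_mul2l le_w orbT.
move=> /negPf nuv; apply: (in_power_nseq uv) => t.
have [->|_] := eqVneq t u; first by rewrite nuv addn0 muln1; apply: leq_trans eu.
by have [->|_] := eqVneq t v; rewrite ?muln0 // muln1; apply: leq_trans ev.
Qed.

(** Large powers of the other leaves [Y] let any other vertex of [X] complete its matching edge.
    Raising only [x1] or only [x2] leaves [x1 x2] as the sole edge, blocked by the exponent at the
    other end. *)
Lemma small_bounds x1 x2 : x1 \in X -> x2 \in X -> adj x1 x2 ->
  m x1 < 2 * w x1 x2 -> m x2 < 2 * w x1 x2 -> False.
Proof.
move=> X1 X2 x12 lt1 lt2.
have n12 := negPf (adj_neq x12).
have w0 := weight_gt0 x12.
pose Y := f @: (X :\ x1 :\ x2).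
have YP v : v \in Y -> exists a, [/\ a \in X, a != x1, a != x2 & v = f a].
  by case/imsetP=> a; rewrite !in_setD1 => /and3P[a2 a1 aX] ->; exists a.
have fY a : a \in X -> a != x1 -> a != x2 -> f a \in Y.
  by move=> aX a1 a2; apply: imset_f; rewrite !in_setD1 a1 a2.
have YX v : v \in X -> (v \in Y) = false.
  by move=> vX; apply/negP => /YP[a [aX _ _ vE]]; move: (f_notin aX); rewrite -vE vX.
pose N := 2 * total_weight.
pose e v := m x1 * (v == x1) + m x2 * (v == x2) + N * (v \in Y).
have N0 : 0 < N by rewrite /N muln_gt0 /=; apply: leq_trans w0 (leq_total_weight _ _).
have out t s : (t, s) = (x1, x2) \/ (t, s) = (x2, x1) -> ~ in_power G 2 (raise e t N).
  move=> ts /in_power_counts => /(_ [:: (x1, x2)] isT)[].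
    have supp u : 0 < raise e t N u -> (u \in [:: x1; x2]) || (u \in Y).
      apply: contraTT; rewrite !inE !negb_or => /andP[/andP[/negPf a /negPf b] /negPf c].
      by rewrite /raise /e a b c; case: ts => -[-> _]; rewrite ?a ?b !muln0.
    have noY u v : u \in Y -> adj u v -> 0 < raise e t N v -> false.
      move=> /YP[a [aX /negPf a1 /negPf a2 ->]]; rewrite f_adjE // => /eqP->.
      by move/supp; rewrite !inE a1 a2 YX.
    move=> u v uv pu pv; have /orP[] := supp u pu; last by move/noY/(_ uv pv).
    have /orP[|/noY H] := supp v pv; last by have := H u (etrans (adjC _ _) uv) pu.
    rewrite !inE => /orP[] /eqP vE /orP[] /eqP uE;
      move: uv; rewrite uE vE ?edge_irrefl //;
      by rewrite !xpair_eqE !eqxx ?orbT.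
  move=> c []; rewrite big_seq1 => c2 /(_ s); rewrite big_seq1 -c2 /= /raise /e.
  case: ts => -[-> ->]; rewrite !eqxx ?(eq_sym x2) n12 YX //; first by clear -lt2; lia.
  by clear -lt1; lia.
(* Together the two sets have [#|X| + 2] elements, one more than allowed. *)
have := power_depth1 (U1 := [set x1; f x2]) (U2 := f x1 |: X :\ x1) (N := N) (e := e)
  (ltn0Sn 1) (CM (ltn0Sn 1)) vertex_coverX N0.
rewrite cards2 cardsU1 in_setD1 (negPf (f_notin X1)) andbF !f_neq //=.
have := cardsD1 x1 X; rewrite X1 => ->; rewrite -ltnS ltnn => H; suff: false by [].
apply: H.
- rewrite -setI_eq0; apply/eqP/setP => v; rewrite !inE; apply/negP => /andP[].
  move=> /orP[] /eqP->; first by rewrite eqxx f_neq.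
  rewrite (negPf (f_notin X2)) andbF orbF => /eqP /(f_inj X2 X1) E.
  by rewrite E eqxx in n12.
- have other u1 x : x \in X -> x != x1 -> x != x2 ->
      in_power G 2 (raise (raise e u1 N) x N).
    move=> xX n1 n2; apply: (in_power_large (f_adj xX)); rewrite /raise.
      by rewrite eqxx muln1 leq_addl.
    by rewrite /e fY // muln1 -!addnA addnCA -/N; clear; lia.
  move=> u1 u2; rewrite !inE => /orP[] /eqP-> /orP[/eqP->|/andP[n1 xX]].
  + apply: (in_power_large (f_adj X1)); rewrite /raise !eqxx muln1 -/N; clear; lia.
  + have [->|n2] := eqVneq u2 x2; last exact: other.
    by apply: (in_power_large x12); rewrite /raise !eqxx muln1 -/N; clear; lia.
  + apply: (@in_power_nseq2 1 1 x1 (f x1) x2 (f x2)); try exact: f_adj.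
    move=> v; rewrite /raise /e.
    have := leq_total_weight x1 (f x1); have := leq_total_weight x2 (f x2).
    rewrite /N; case: (v == x1); case: (v == x2); case: (v == f x1); case: (v == f x2);
    clear; lia.
  + have [->|n2] := eqVneq u2 x2; last exact: other.
    by apply: (in_power_large (f_adj X2)); rewrite /raise !eqxx muln1 -/N; clear; lia.
- by exists x1; [rewrite !inE eqxx|apply: (out _ x2); left].
- exists x2; last by apply: (out _ x1); right.
  by rewrite !inE X2 (eq_sym x2 x1) n12 orbT.
Qed.

Lemma matched_weight_bound x1 x2 : x1 \in X -> x2 \in X -> adj x1 x2 ->
  2 * w x1 x2 <= m x1.
Proof.
move=> X1 X2 x12; rewrite leqNgt; apply/negP => lt1.
have [lt2|] := ltnP (m x2) (2 * w x1 x2); first exact: small_bounds lt1 lt2.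
exact: mixed_bound lt1.
Qed.

(** Here [a], [b], [c], [d] count the edges [x f(x)], [xy], [yz], [y f(y)]. The bound at [y] forces
    [a > 0], hence [a = 1] and [b = d = 0]; then [c = mx + mz + 1] is too large for [z]. *)
Lemma weight_counts a b c d mx my mz wt : 0 < mx -> 0 < wt -> 2 * wt <= my ->
  mx + mz + 2 = a + (b + (c + d)) ->
  b * wt + (c * wt + d * my) <= wt * (mx + mz + 2).-1 -> c * wt <= mz ->
  a = 0 \/ a * mx + b * wt <= mx -> False.
Proof.
move=> mx0 w0 my2 E Hy Hz Ha.
have {}Hy : b + c + 2 * d <= (mx + mz + 2).-1.
  by rewrite -(leq_pmul2l w0); apply: leq_trans Hy; nia.
have a1 : a <= 1.
  by case: Ha => [->//|Ha]; rewrite -(leq_pmul2r mx0) mul1n; lia.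
have [a0|a0] : a = 0 \/ a = 1 by lia.
  by lia.
have b0 : b = 0.
  by case: Ha => [|Ha]; [rewrite a0|apply/eqP; rewrite -(eqn_pmul2r w0) mul0n; lia].
have : c <= c * wt by rewrite leq_pmulr.
by lia.
Qed.

(** Edges [xy] and [yz] of equal weight cost the same at [y], whose exponent has room for [n - 1] of
    them. Raising [f x] and [z] together admits [x f(x)] and [n - 1] copies of [yz], and
    symmetrically; raising only [x] or only [f x] fails by [weight_counts]. *)
Lemma distinct_weights x y z : x \in X -> y \in X -> z \in X -> adj x y -> adj y z ->
  x != z -> w x y <> w y z.
Proof.
move=> xX yX zX xy yz xz wE.
have yx : adj y x by rewrite adjC.
have nxy := negPf (adj_neq xy); have nyz := negPf (adj_neq yz); have nxz := negPf xz.
have nadj : adj x z = false by apply: no_triangle yz.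
have w0 := weight_gt0 xy; have mx := m_gt0 xX; have mz := m_gt0 zX.
have my : 2 * w x y <= m y by rewrite -(weight_sym yx); apply: matched_weight_bound.
pose Y := f @: (X :\ x :\ z).
have YP v : v \in Y -> exists a, [/\ a \in X, a != x, a != z & v = f a].
  by case/imsetP=> a; rewrite !in_setD1 => /and3P[a2 a1 aX] ->; exists a.
have fY a : a \in X -> a != x -> a != z -> f a \in Y.
  by move=> aX a1 a2; apply: imset_f; rewrite !in_setD1 a1 a2.
have YX v : v \in X -> (v \in Y) = false.
  by move=> vX; apply/negP => /YP[a [aX _ _ vE]]; move: (f_notin aX); rewrite -vE vX.
have fYF v : v \in X -> (v == x) || (v == z) -> (f v \in Y) = false.
  move=> vX vxz; apply/negP => /YP[a [aX ax az /(f_inj vX aX) va]].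
  by move: vxz; rewrite va (negPf ax) (negPf az).
pose n := m x + m z + 2; pose N := n * total_weight.
pose e v := m x * (v == x) + w x y * n.-1 * (v == y) + m z * (v == z) + N * (v \in Y).
have n0 : 0 < n by rewrite /n addn2.
have N0 : 0 < N by rewrite /N muln_gt0 n0; apply: leq_trans w0 (leq_total_weight _ _).
have out t : t \in [:: x; f x] -> ~ in_power G n (raise e t N).
  move=> tE /in_power_counts => /(_ [:: (x, f x); (x, y); (y, z); (y, f y)])[].
  - rewrite /= !inE !xpair_eqE !eqxx nxy /= !f_neq //.
  - have supp u : 0 < raise e t N u -> (u \in [:: x; f x; y; z]) || (u \in Y).
      apply: contraTT; rewrite !inE !negb_or.
      move=> /andP[/and4P[/negPf a /negPf b /negPf c /negPf d] /negPf g].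
      rewrite /raise /e a c d g !muln0 !add0n -eqn0Ngt muln_eq0.
      by move: tE; rewrite !inE => /orP[] /eqP->; rewrite ?a ?b orbT.
    have inY u v : u \in Y -> adj u v -> 0 < raise e t N v -> (v == y) && (u == f y).
      move=> /YP[a [aX /negPf ax /negPf az ->]]; rewrite (f_adjE _ aX) => /eqP->.
      move/supp; rewrite (YX a aX) orbF !inE ax az (f_neq xX aX) orbF /= => /eqP->.
      by rewrite !eqxx.
    move=> u v uv pu pv; have /orP[] := supp u pu; last first.
      by move/inY/(_ uv pv) => /andP[/eqP-> /eqP->]; rewrite !inE !eqxx !orbT.
    have /orP[|/inY H] := supp v pv; last first.
      have /andP[/eqP-> /eqP->] := H u (etrans (adjC _ _) uv) pu.
      by rewrite !inE !eqxx !orbT.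
    rewrite !inE => /or4P[] /eqP vE /or4P[] /eqP uE;
      move: uv; rewrite uE vE ?edge_irrefl ?(f_adjE _ xX) ?(adjC z x) ?nadj ?nxy
       ?(eq_sym z x) ?(eq_sym y x) ?nxy ?nxz //;
      by rewrite !xpair_eqE !eqxx ?orbT.
  - move=> c []; rewrite !big_cons big_nil /= => cn H.
    move: (H x) (H (f x)) (H y) (H z); rewrite !big_cons !big_nil /= {H}.
    rewrite /raise /e !eqxx.
    have e1 := (f_neq xX xX, f_neq xX yX, f_neq xX zX, f_neq yX xX, f_neq yX yX, f_neq yX zX).
    rewrite !e1 (YX x xX) (YX y yX) (YX z zX) (fYF x xX) ?eqxx //.
    rewrite ?(eq_sym y x) ?(eq_sym z x) ?(eq_sym z y) nxy nxz nyz.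
    rewrite (inj_in_eq f_inj) // nxy -wE.
    have {}tE : ((y == t = false) * (z == t = false)) * ((t == x) || (t == f x)).
      by move: tE; rewrite !inE => /orP[] /eqP->;
        rewrite ?e1 ?(eq_sym y x) ?(eq_sym z x) ?nxy ?nxz ?eqxx ?orbT.
    rewrite !tE ?(muln0, muln1, addn0, add0n) => Hx Hfx Hy Hz.
    rewrite addn0 in cn; apply: (weight_counts mx w0 my cn Hy Hz).
    case/orP: tE.2 => /eqP tE'; [left|right].
      by move: Hfx; rewrite tE' e1 muln0 leqn0 muln_eq0 (gtn_eqF mx) orbF => /eqP.
    by move: Hx; rewrite tE' e1 muln0 addn0.
- have := power_depth1 (U1 := [set f x; f z]) (U2 := X) (N := N) (e := e)
    n0 (CM n0) vertex_coverX N0.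
  rewrite cards2 (inj_in_eq f_inj) // nxz /= -ltnS ltnn => H; suff: false by [].
  apply: H.
  + rewrite -setI_eq0; apply/eqP/setP => v; rewrite !inE; apply/negP => /andP[].
    by move=> /orP[] /eqP->; apply/negP/f_notin.
  + have Hyz u : u \in X -> adj y u -> (u == x) || (u == z) -> w y u = w x y ->
        forall u', u' != u -> (u' == x) || (u' == z) -> u' \in X ->
        in_power G n (raise (raise e (f u') N) u N).
      move=> uX yu uxz wu u' u'u u'xz u'X.
      have -> : n = 1 + n.-1 by rewrite /n addn2.
      apply: (@in_power_nseq2 1 n.-1 u' (f u') y u) => //; first exact: f_adj.
      move=> v; rewrite wu /raise /e mul1n !mulnDr.
      have mN : m u' <= N.
        by apply: leq_trans (leq_total_weight _ _) _; rewrite /N leq_pmull.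
      have wN : n.-1 * w x y <= N by rewrite leq_mul ?leq_pred ?leq_total_weight.
      have : m u' * (v == u') <= m x * (v == x) + m z * (v == z).
        by case/orP: u'xz => /eqP->; rewrite ?leq_addr ?leq_addl.
      have : m u' * (v == f u') <= N * (v == f u') by rewrite leq_mul2r mN orbT.
      have : n.-1 * (w x y * (v == u)) <= N * (v == u).
        by rewrite mulnA leq_mul2r wN orbT.
      have : n.-1 * (w x y * (v == y)) = w x y * n.-1 * (v == y) by rewrite mulnCA mulnA.
      by clear; lia.
    have wyx : w y x = w x y by rewrite weight_sym.
    move=> u1 u2; rewrite !inE => u1E u2X.
    have [u' u'xz ->] : exists2 u', (u' == x) || (u' == z) & u1 = f u'.
      by case/orP: u1E => /eqP->; [exists x|exists z]; rewrite ?eqxx ?orbT.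
    have u'X : u' \in X by case/orP: u'xz => /eqP->.
    have [u2E|u2u'] := eqVneq u2 u'.
      by apply: (in_power_large (f_adj u'X)); rewrite /raise u2E !eqxx !muln1 -/N; clear; lia.
    have [u2xz|] := boolP ((u2 == x) || (u2 == z)).
      rewrite eq_sym in u2u'; apply: Hyz u'X => //.
        by case/orP: u2xz => /eqP->.
      by case/orP: u2xz => /eqP->.
    rewrite negb_or => /andP[u2x u2z]; apply: (in_power_large (f_adj u2X)); rewrite /raise.
      by rewrite eqxx muln1 -/N; clear; lia.
    by rewrite /e (fY u2) // muln1 -/N; clear; nia.
  + by exists (f x); [rewrite !inE eqxx|apply: out; rewrite !inE eqxx orbT].
  + by exists x => //; apply: out; rewrite inE eqxx.
Qed.

(* With [p = w x y] and [q = w y z], [d + 2] is the ceiling of [q / (q - p)]. *)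
Lemma lower_bound_near x y z d : x \in X -> y \in X -> z \in X -> adj x y -> adj y z ->
  x != z -> w x y * d.+2 <= w y z * d.+1 -> w y z * d < w x y * d.+1 ->
  w x y * d.+2 <= m x.
Proof.
move=> xX yX zX xy yz xz pq qp; rewrite leqNgt; apply/negP => lt.
have yx : adj y x by rewrite adjC.
have nxy := negPf (adj_neq xy); have nyz := negPf (adj_neq yz); have nxz := negPf xz.
have nadj : adj x z = false by apply: no_triangle yz.
pose e v := m x * (v == x) + w y z * d.+1 * (v == y) + w y z * d.+1 * (v == z).
apply: (@no_matched_pair d.+2 e x) => //.
- move/in_power_counts => /(_ [:: (x, y); (y, z)])[].
  + by rewrite /= !inE !xpair_eqE nxy.
  + have supp u : 0 < e u -> u \in [:: x; y; z].
      by apply: contraTT; rewrite !inE !negb_or => /and3P[/negPf a /negPf b /negPf c];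
        rewrite /e a b c !muln0.
    move=> u v + /supp + /supp; rewrite !inE => uv /or3P[] /eqP uE /or3P[] /eqP vE;
      move: uv; rewrite uE vE ?edge_irrefl ?(adjC z x) ?nadj //;
      by rewrite !xpair_eqE !eqxx ?orbT.
  move=> c []; rewrite !big_cons big_nil /= => cn H.
  move: (H x) (H y) (H z); rewrite !big_cons !big_nil /e /= {H}.
  rewrite !eqxx ?(eq_sym y x) ?(eq_sym z x) ?(eq_sym z y) nxy nxz nyz.
  rewrite addn0 in cn; rewrite ?(muln0, muln1, addn0, add0n).
  move: (weight_gt0 xy) pq qp lt cn; move: (c (x, y)) (c (y, z)) => s t.
  move: (w x y) (w y z) (m x) => p q mi; clear => p0 pq qp lt cn Hx Hy Hz.
  (* The bound at [x] gives [s <= d + 1]; the bound at [y] becomes [p s <= q (s - 1)], so [s] is at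
     least [q / (q - p)], which exceeds [d + 1]. *)
  have s1 : s <= d.+1.
    by rewrite -ltnS -(ltn_pmul2r p0); apply: leq_ltn_trans Hx _; rewrite mulnC.
  have tE : t = d.+2 - s by lia.
  case: s s1 tE {cn Hx Hz} Hy => [|s] s1 tE Hy; first by rewrite tE in Hy; nia.
  have {}Hy : p * s.+1 <= q * s.
    have : t + s = d.+1 by lia.
    nia.
  suff : d < s by lia.
  nia.
- exists (w x y * d.+2); apply: (in_power_nseq xy) => v.
  rewrite /raise /e; move: pq.
  by case: (v == x); case: (v == y); case: (v == z); clear; nia.
- exists (m x); apply: (@in_power_nseq2 1 d.+1 x (f x) y z) => //; first exact: f_adj.
  move=> v; rewrite /raise /e.
  by case: (v == x); case: (v == y); case: (v == z); case: (v == f x); clear; nia.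
Qed.

(** Raising [z] admits [x f(x)] and [d] copies of [yz]. Raising [f z] admits [z f(z)] and [d] copies
    of [xy], for which [lower_bound_near] makes the exponent at [x] large enough. *)
Lemma lower_bound_far x y z d : x \in X -> y \in X -> z \in X -> adj x y -> adj y z ->
  x != z -> w x y < w y z -> w x y * d.+2 <= w y z * d.+1 -> w y z * d < w x y * d.+1 ->
  w y z * d <= m z.
Proof.
move=> xX yX zX xy yz xz pq' pq qp; rewrite leqNgt; apply/negP => lt.
have mx := lower_bound_near xX yX zX xy yz xz pq qp.
have yx : adj y x by rewrite adjC.
have nxy := negPf (adj_neq xy); have nyz := negPf (adj_neq yz); have nxz := negPf xz.
have nadj : adj x z = false by apply: no_triangle yz.
pose e v := m x * (v == x) + m x * (v == f x) + w y z * d * (v == y) + m z * (v == z).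
apply: (@no_matched_pair d.+1 e z) => //.
- move/in_power_counts => /(_ [:: (x, f x); (x, y); (y, z)])[].
  + by rewrite /= !inE !xpair_eqE !eqxx nxy /= !f_neq.
  + have supp u : 0 < e u -> u \in [:: x; f x; y; z].
      by apply: contraTT; rewrite !inE !negb_or =>
        /and4P[/negPf a /negPf b /negPf c /negPf g]; rewrite /e a b c g !muln0.
    move=> u v + /supp + /supp; rewrite !inE => uv /or4P[] /eqP uE /or4P[] /eqP vE;
      move: uv; rewrite uE vE ?edge_irrefl ?(f_adjE _ xX) ?(adjC z x) ?nadj
        ?(eq_sym y x) ?(eq_sym z x) ?nxy ?nxz //;
      by rewrite !xpair_eqE !eqxx ?orbT.
  move=> c []; rewrite !big_cons big_nil /= => cn H.
  move: (H x) (H (f x)) (H y) (H z); rewrite !big_cons !big_nil /e /= {H}.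
  have e1 := (f_neq xX xX, f_neq xX yX, f_neq xX zX).
  rewrite !eqxx !e1 ?(eq_sym y x) ?(eq_sym z x) ?(eq_sym z y) nxy nxz nyz.
  rewrite addn0 in cn; rewrite ?(muln0, muln1, addn0, add0n).
  move: (weight_gt0 xy) (m_gt0 xX) pq' pq qp lt mx cn.
  move: (c (x, f x)) (c (x, y)) (c (y, z)) => r s t.
  move: (w x y) (w y z) (m x) (m z) => p q mi mk; clear.
  move=> p0 mi0 pq' pq qp lt mx cn Hx Hf Hy Hz.
  have r1 : r <= 1 by rewrite -(leq_pmul2r mi0) mul1n.
  have td : t < d by rewrite -(ltn_pmul2l (ltn_trans p0 pq')) mulnC; apply: leq_ltn_trans lt.
  (* Without [x f(x)] the bound at [y] gives [p (d + 1) <= q d]; with it [x] is exhausted, and [d]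
     copies of [yz] would be needed. *)
  have [r0|r0] : r = 0 \/ r = 1 by lia.
    have : p * (s + t) <= s * p + t * q by nia.
    have -> : s + t = d.+1 by lia.
    by nia.
  have s0 : s = 0 by apply/eqP; rewrite -(eqn_pmul2r p0) mul0n; nia.
  by lia.
- exists (w y z * d.+1 + m x); rewrite -add1n.
  apply: (@in_power_nseq2 1 d x (f x) y z) => //; first exact: f_adj.
  move=> v; rewrite /raise /e.
  by case: (v == x); case: (v == y); case: (v == z); case: (v == f x); clear; nia.
- exists (m z); rewrite -add1n.
  apply: (@in_power_nseq2 1 d z (f z) x y) => //; first exact: f_adj.
  move=> v; rewrite /raise /e; move: mx pq'.
  by case: (v == x); case: (v == y); case: (v == z); case: (v == f x); case: (v == f z);
    clear; nia.
Qed.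

End CohenMacaulayTrees.

(** The ratio exceeds [1], so its ceiling has the form [d + 2]; the inequalities are
    [d + 1 < q / (q - p) <= d + 2] with denominators cleared. *)
Lemma ceil_ratio (p q : nat) : (0 < p < q)%N -> exists d : nat,
  [/\ Num.ceil (q%:R / (q%:R - p%:R) : rat) = (d.+2)%:Z,
      (p * d.+2 <= q * d.+1)%N & (q * d < p * d.+1)%N].
Proof.
move=> /andP[p0 pq]; set c := Num.ceil _.
have pqR : 0 < (q%:R - p%:R : rat) by rewrite Num.Theory.subr_gt0 Num.Theory.ltr_nat.
have /andP[] := Num.Theory.ceil_itv (q%:R / (q%:R - p%:R) : rat).
rewrite -/c Num.Theory.ltr_pdivlMr // Num.Theory.ler_pdivrMr //.
rewrite !pmulrn -!rmorphB -!rmorphM ltr_int ler_int => lo hi.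
have c2 : 2 <= c by clear -lo hi pq p0; nia.
exists `|c - 2|%N.
have cE : c = (`|c - 2|%N.+2)%:Z by clear -c2; lia.
split=> //.
  by clear -lo hi cE; nia.
by clear -lo hi cE; nia.
Qed.

Theorem proposition4p7 (K : fieldType) (V : finType) (G : weighted_graph V)
    (hG : tree G) (hE : exists u v : V, edge G u v)
    (hCM : forall n : nat, (1 <= n)%N ->
       cohen_macaulay_ideal (ideal_pow (weighted_edge_ideal G (K := K)) n)) :
  exists (t : nat) (x y : 'I_t -> V),
    [/\ injective (fun i => [set x i; y i]),
        perfect_matching G [set [set x i; y i] | i : 'I_t],
        forall i, leaf G (y i)
      & let w (i j : 'I_t) := weight G (x i) (x j) in
        let m (i : 'I_t) := weight G (x i) (y i) in
        (forall i j, edge G (x i) (x j) -> (2 * w i j <= minn (m i) (m j))%N)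
        /\
        (forall i j k,
           edge G (x i) (x j) -> edge G (x j) (x k) -> i != k ->
           w i j <> w j k /\
           ((w i j < w j k)%N ->
            let c : int :=
              Num.ceil ((w j k)%:R / ((w j k)%:R - (w i j)%:R) : rat) in
            (w i j)%:Z * c <= (m i)%:Z /\
            (w j k)%:Z * (c - 2) <= (m k)%:Z))].
Proof.
have [connG acycG] := hG.
have [X [f [fadj fX fleaf coverX]]] := leaf_matching acycG connG hCM hE.
pose x (i : 'I_#|X|) := enum_val i.
have xX i : x i \in X by apply: enum_valP.
have neq_xf i j : x i <> f (x j) by move=> E; have := fX _ (xX j); rewrite -E xX.
have f_xinj i j : f (x i) = f (x j) -> i = j.
  by move/(f_inj fadj fleaf (xX i) (xX j))/enum_val_inj.
exists #|X|, x, (f \o x); split=> /=.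
- move=> i j /setP /(_ (x i)); rewrite !inE eqxx /= => /esym /orP[] /eqP.
    by move/enum_val_inj.
  by move/neq_xf.
- split.
    apply/subsetP => _ /imsetP[i _ ->]; apply/imsetP; exists (x i, f (x i)) => //.
    by rewrite inE; apply: (fadj _ (xX i)).
  apply/and3P; split.
  + apply/eqP/setP => v; rewrite inE; apply/bigcupP.
    suff [i iE] : exists i, v \in [set x i; f (x i)].
      by exists [set x i; f (x i)] => //; apply: imset_f.
    have [vX|/coverX[a aX ->]] := boolP (v \in X).
      by exists (enum_rank_in vX v); rewrite /x enum_rankK_in // !inE eqxx.
    by exists (enum_rank_in aX a); rewrite /x enum_rankK_in // !inE eqxx orbT.
  + apply/trivIsetP => _ _ /imsetP[i _ ->] /imsetP[j _ ->] ij.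
    rewrite -setI_eq0; apply/eqP/setP => v; rewrite !inE; apply/negP => /andP[vi vj].
    have nij : i <> j by move=> E; rewrite E eqxx in ij.
    case/orP: vi => /eqP vE; case/orP: vj; rewrite vE => /eqP E.
    * by apply: nij; move/enum_val_inj: E.
    * exact: neq_xf E.
    * exact: neq_xf (esym E).
    * exact/nij/f_xinj/E.
  + apply/imsetP => [[i _ /esym/setP/(_ (x i))]].
    by rewrite !inE eqxx.
- move=> i; rewrite /leaf -(cards1 (x i)); apply: eq_card => u.
  by rewrite !inE (f_adjE fadj fleaf _ (xX i)).
- split=> [i j ij|i j k ij jk ik].
    rewrite leq_min (matched_weight_bound hCM fadj fX fleaf coverX) //.
    rewrite weight_sym // (matched_weight_bound hCM fadj fX fleaf coverX) //.
    by rewrite edge_sym.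
  have nik : x i != x k by apply: contra ik => /eqP /enum_val_inj ->.
  split; first exact: (distinct_weights acycG hCM fadj fX fleaf coverX).
  move=> lt; have [|d [-> dle dlt]] := ceil_ratio (p := weight G (x i) (x j))
    (q := weight G (x j) (x k)); first by rewrite weight_gt0.
  have b1 := lower_bound_near acycG hCM fadj fX fleaf coverX
    (xX i) (xX j) (xX k) ij jk nik dle dlt.
  have b2 := lower_bound_far acycG hCM fadj fX fleaf coverX
    (xX i) (xX j) (xX k) ij jk nik lt dle dlt.
  (* With the ceiling equal to [d + 2], [b1] is (a) and [b2] is (b). *)
  by split; move: b1 b2; clear; lia.
Qed.
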